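(* For all integers $m\geq 1$ and $n\geq 0$, \[ M_{bd}(m-1,n)\geq M_{bd}(m,n), \] except when $(m,n)=(1,1)$, $(1,5)$ or $(1,7)$.
   Context: A partition with designated summands is an integer partition in which, for each distinct part size occurring, exactly one of the parts of that size is tagged (designated). A bipartition of $n$ with designated summands is an ordered pair $(\lambda_1,\lambda_2)$ of partitions with designated summands with $|\lambda_1|+|\lambda_2|=n$. Fix a bijection $\Delta$ (such a bijection exists) between partitions of $N$ with designated summands and pairs $(\alpha,\beta)$ with $|\alpha|+|\beta|=N$, where $\alpha$ is an ordinary partition and $\beta$ is a partition into parts $\not\equiv\pm1 \pmod 6$. If $\Delta(\lambda_1)=(\alpha_1,\beta_1)$ and $\Delta(\lambda_2)=(\alpha_2,\beta_2)$, the $pd$-crank of $(\lambda_1,\lambda_2)$ is $\ell(\alpha_1)-\ell(\alpha_2)$, where $\ell(\alpha)$ is the number of parts of $\alpha$. Because $\Delta$ is a bijection, $M_{bd}(m,n)$, the number of bipartitions of $n$ with designated summands having $pd$-crank $m$, equals the number of quadruples $(\alpha_1,\beta_1,\alpha_2,\beta_2)$ with $\alpha_1,\alpha_2$ ordinary partitions, $\beta_1,\beta_2$ partitions into parts $\not\equiv\pm1\pmod 6$, total size $n$ and $\ell(\alpha_1)-\ell(\alpha_2)=m$. Equivalently, \[ \sum_{m\in\mathbb Z}\sum_{n\ge0}M_{bd}(m,n)z^mq^n=\frac{(q^6;q^6)_\infty^2}{(zq;q)_\infty(z^{-1}q;q)_\infty(q^2;q^2)_\infty^2(q^3;q^3)_\infty^2},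 \] where $(a;q)_\infty=\prod_{j\ge1}(1-aq^{j-1})$. *)

(* Defs.v *)
From HB Require Import structures.
From mathcomp Require Import all_boot all_order all_algebra finmap.
From mathcomp Require Import all_classical.

Set Implicit Arguments.
Unset Strict Implicit.
Unset Printing Implicit Defensive.

Import Order.TTheory GRing.Theory Num.Theory.

Local Open Scope nat_scope.

(* A partition is the weakly decreasing sequence of its (positive) parts. *)
Definition is_partition (s : seq nat) : bool := sorted geq s && (0 \notin s).

Record partition_of_int := PartitionOfInt {
  parts :> seq nat;
  partsP : is_partition parts }.

HB.instance Definition _ := [isSub for parts].
HB.instance Definition _ := [Choice of partition_of_int by <:].

Definition weight (a : partition_of_int) : nat := sumn a.

Definition num_parts (a : partition_of_int) : nat := size a.

Definition avoids_pm1_mod6 (b : partition_of_int) : bool :=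
  all (fun k => (k != 1 %[mod 6]) && (k != 5 %[mod 6])) b.

Record partition_npm1 := PartitionNpm1 {
  npm1_val :> partition_of_int;
  npm1P : avoids_pm1_mod6 npm1_val }.

HB.instance Definition _ := [isSub for npm1_val].
HB.instance Definition _ := [Choice of partition_npm1 by <:].

(* Each part k is stored as (k, t), where t tells whether that occurrence of k
   is the designated one.  Only the part sizes are required to be sorted, so
   the position of the tag among equal parts is significant: 2' + 2 and 2 + 2'
   are distinct. *)
Definition is_designated (s : seq (nat * bool)) : bool :=
  is_partition (unzip1 s) &&
  all (fun k => count_mem (k, true) s == 1) (unzip1 s).

Record dpartition := DPartition {
  dparts :> seq (nat * bool);
  dpartsP : is_designated dparts }.

HB.instance Definition _ := [isSub for dparts].
HB.instance Definition _ := [Choice of dpartition by <:].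

Definition dweight (l : dpartition) : nat := sumn (unzip1 l).

(* A family, indexed by N, of bijections between the partitions of N with
   designated summands and the pairs (alpha, beta) of total size N is the same
   thing as one weight-preserving bijection. *)
Definition pd_bijection
    (Delta : dpartition -> partition_of_int * partition_npm1) : Prop :=
  bijective Delta /\
  forall l : dpartition, weight (Delta l).1 + weight (Delta l).2 = dweight l.

Definition bweight (L : dpartition * dpartition) : nat := dweight L.1 + dweight L.2.

Definition pd_crank (Delta : dpartition -> partition_of_int * partition_npm1)
    (L : dpartition * dpartition) : int :=
  ((num_parts (Delta L.1).1)%:Z - (num_parts (Delta L.2).1)%:Z)%R.

Definition crank_class
    (Delta : dpartition -> partition_of_int * partition_npm1)
    (m : int) (n : nat) : set (dpartition * dpartition) :=
  [set L | bweight L = n /\ pd_crank Delta L = m]%classic.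

(* fset_set is only meaningful on finite sets; see finite_crank_class. *)
Definition M_bd (Delta : dpartition -> partition_of_int * partition_npm1)
    (m : int) (n : nat) : nat :=
  #|` fset_set (crank_class Delta m n)|.

Lemma finite_dweight_le (n : nat) :
  finite_set [set l : dpartition | dweight l <= n]%classic.
Proof.
pose g (t : n.-bseq ('I_n.+1 * bool)) : seq (nat * bool) :=
  [seq (val x.1, x.2) | x <- t].
have finB : finite_set (range g) by apply: finite_image; exact: finite_finset.
have injd : {in (dparts @^-1` range g)%classic &, injective dparts}.
  by move=> l1 l2 _ _; exact: val_inj.
apply: sub_finite_set (finite_preimage injd finB) => l /= le_ln.
case: l le_ln => s ds; rewrite /dweight /= => le_sn.
have /andP[/andP[_ s0] _] := ds.
have le_part x : x \in s -> x.1 < n.+1.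
  move=> xs; rewrite ltnS; apply: leq_trans le_sn.
  elim: s {ds s0} xs => //= y s IHs; rewrite inE => /orP[/eqP<-|/IHs xs].
    exact: leq_addr.
  exact: leq_trans xs (leq_addl _ _).
have sz_s : size s <= n.
  apply: leq_trans le_sn; elim: s s0 {ds le_part} => //= y s IHs.
  rewrite inE negb_or eq_sym -lt0n => /andP[y0 /IHs].
  by rewrite -addn1 addnC => /(leq_add y0).
pose h (x : nat * bool) : 'I_n.+1 * bool := (inord x.1, x.2).
have sz_t : size (map h s) <= n by rewrite size_map.
exists (Bseq sz_t) => //; rewrite /g /= -map_comp -[RHS]map_id.
apply/eq_in_map => -[k t] kt /=; congr pair.
by rewrite inordK //; exact: (le_part _ kt).
Qed.

Lemma finite_crank_class
    (Delta : dpartition -> partition_of_int * partition_npm1)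
    (m : int) (n : nat) : finite_set (crank_class Delta m n).
Proof.
apply: sub_finite_set (finite_setX (finite_dweight_le n) (finite_dweight_le n)).
move=> [l1 l2] [/= <- _]; rewrite /bweight /=.
by split=> /=; [exact: leq_addr | exact: leq_addl].
Qed.

(* Main.v *)
Require Import Defs.
From mathcomp Require Import all_boot all_order all_algebra.
From HB Require Import structures.
From mathcomp Require Import finmap.
From mathcomp Require Import boolp classical_sets cardinality.
From mathcomp Require Import zify ring.

(* Write z for the variable marking the difference of the numbers of parts, and
   chi_a = z^-a + ... + z^a for the irreducible characters of SO(3).  The claim is
   that, apart from three terms, every coefficient of the generating function is a
   combination of the chi_a with nonnegative coefficients, since the coefficient of
   chi_a is M(a, n) - M(a + 1, n).

   For vectors v_i of degree i in the 3-dimensional representation V, the product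
   of the 1/((1 - z q^i)(1 - q^i/z)) is the graded character of Sym(V q + V q^2 + ...)
   times prod_i (1 - q^i).  Killing the invariants v_i.v_i and v_i.v_(i+1), of
   degrees 2, 3, 4, ..., from which a complete intersection arises, multiplies the
   character of Sym by prod_(n >= 2) (1 - q^n) and keeps it positive; only the
   factor 1 - q and the explicit scalar series in q are left over.  Positivity of the
   character of the chain of the v_i is proved by adding one vector at a time.  To
   absorb 1 - q, the first two vectors are treated explicitly, together with the
   bound that, in the rest of the chain, chi_1 occurs at least as often as chi_0 up
   to an explicit error; what remains is a one-variable inequality, and this is where
   q + q^5 + q^7 comes from. *)

Set Implicit Arguments.
Unset Strict Implicit.
Unset Printing Implicit Defensive.

Import Order.TTheory GRing.Theory Num.Theory.

Local Open Scope ring_scope.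

(** * Formal power series *)

Record fps (R : Type) := Fps { coef :> nat -> R }.

HB.instance Definition _ (R : Type) := gen_eqMixin (fps R).
HB.instance Definition _ (R : Type) := gen_choiceMixin (fps R).

Lemma fpsP (R : Type) (F G : fps R) : (forall n, F n = G n) -> F = G.
Proof. by case: F G => f [g] /= fg; congr Fps; apply: funext. Qed.

Section FpsRing.
Variable R : comNzRingType.
Implicit Types F G H : fps R.

Definition fps0 : fps R := Fps (fun=> 0).
Definition fps1 : fps R := Fps (fun n => (n == 0)%:R).
Definition fps_opp F : fps R := Fps (fun n => - F n).
Definition fps_add F G : fps R := Fps (fun n => F n + G n).
Definition fps_mul F G : fps R := Fps (fun n => \sum_(i < n.+1) F i * G (n - i)%N).

Fact fps_addA : associative fps_add.
Proof. by move=> F G H; apply: fpsP => n /=; rewrite addrA. Qed.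
Fact fps_addC : commutative fps_add.
Proof. by move=> F G; apply: fpsP => n /=; rewrite addrC. Qed.
Fact fps_add0 : left_id fps0 fps_add.
Proof. by move=> F; apply: fpsP => n /=; rewrite add0r. Qed.
Fact fps_addN : left_inverse fps0 fps_opp fps_add.
Proof. by move=> F; apply: fpsP => n /=; rewrite addNr. Qed.

HB.instance Definition _ :=
  GRing.isZmodule.Build (fps R) fps_addA fps_addC fps_add0 fps_addN.

(** Products in degree at most N depend only on truncations, so the ring axioms are inherited from
    polynomials. *)
Let trunc N F : {poly R} := \poly_(i < N.+1) F i.

Let trunc_mul N F G m : (m <= N)%N ->
  fps_mul F G m = (trunc N F * trunc N G)`_m.
Proof.
move=> mN; rewrite coefM /=; apply: eq_bigr => i _.
have iN : (i <= N)%N by apply: leq_trans mN; rewrite -ltnS.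
by rewrite !coef_poly !ltnS iN (leq_trans (leq_subr _ _) mN).
Qed.

Let trunc_coefM N F (p : {poly R}) m : (m <= N)%N ->
  (forall i, (i <= N)%N -> F i = p`_i) ->
  forall r : {poly R}, (trunc N F * r)`_m = (p * r)`_m.
Proof.
move=> mN Fp r; rewrite !coefM; apply: eq_bigr => i _.
have iN : (i <= N)%N by apply: leq_trans mN; rewrite -ltnS.
by rewrite coef_poly ltnS iN Fp.
Qed.

Fact fps_mulC : commutative fps_mul.
Proof. by move=> F G; apply: fpsP => n; rewrite !(@trunc_mul n) // mulrC. Qed.
Fact fps_mulA : associative fps_mul.
Proof.
move=> F G H; apply: fpsP => n; rewrite fps_mulC !(@trunc_mul n) //.
rewrite (@trunc_coefM n _ (trunc n G * trunc n H)) //; last by move=> i; exact: trunc_mul.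
rewrite (@trunc_coefM n (fps_mul F G) (trunc n F * trunc n G)) //; last first.
  by move=> i; exact: trunc_mul.
by rewrite mulrC mulrA.
Qed.
Fact fps_mul1 : left_id fps1 fps_mul.
Proof.
move=> F; apply: fpsP => n /=; rewrite big_ord_recl /= mul1r subn0 big1 ?addr0 //.
by move=> i _; rewrite mul0r.
Qed.
Fact fps_mulDl : left_distributive fps_mul fps_add.
Proof.
move=> F G H; apply: fpsP => n /=; rewrite -big_split /=.
by apply: eq_bigr => i _; rewrite mulrDl.
Qed.
Fact fps_1_neq0 : fps1 != fps0.
Proof.
by apply/eqP => /(congr1 (fun F : fps R => F 0%N)) /= /eqP; rewrite oner_eq0.
Qed.

HB.instance Definition _ := GRing.Zmodule_isComNzRing.Build (fps R)
  fps_mulA fps_mulC fps_mul1 fps_mulDl fps_1_neq0.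

Lemma coef_fpsD F G n : (F + G) n = F n + G n. Proof. by []. Qed.
Lemma coef_fpsB F G n : (F - G) n = F n - G n. Proof. by []. Qed.
Lemma coef_fps1 n : (1 : fps R) n = (n == 0)%:R. Proof. by []. Qed.
Lemma coef_fpsM F G n : (F * G) n = \sum_(i < n.+1) F i * G (n - i)%N.
Proof. by []. Qed.

Definition q : fps R := Fps (fun n => (n == 1)%:R).

Lemma coef_qM F n : (q * F) n = if n is n'.+1 then F n' else 0.
Proof.
rewrite coef_fpsM; case: n => [|n]; first by rewrite big_ord1 mul0r.
rewrite 2!big_ord_recl /= mul0r add0r mul1r subn1 big1 ?addr0 // => i _.
by rewrite mul0r.
Qed.

Lemma coef_qnM k F n : (q ^+ k * F) n = if (n < k)%N then 0 else F (n - k)%N.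
Proof.
elim: k n => [|k IHk] n; first by rewrite mul1r subn0.
by rewrite exprS -mulrA coef_qM; case: n.
Qed.

Lemma coef_q k n : (q ^+ k) n = (n == k)%:R.
Proof.
rewrite -[q ^+ k]mulr1 coef_qnM coef_fps1 subn_eq0 eqn_leq.
by case: ltnP => _; rewrite ?andbT ?andbF.
Qed.

Definition geo k : fps R := Fps (fun n => (k %| n)%:R).

Lemma geoE k : (0 < k)%N -> (1 - q ^+ k) * geo k = 1.
Proof.
move=> k0; apply: fpsP => n; rewrite mulrBl mul1r coef_fpsB coef_qnM coef_fps1 /=.
case: ltnP => [nk|kn].
  by rewrite subr0; case: n nk => [|n] nk; rewrite ?dvdn0 // gtnNdvd.
rewrite dvdn_subl // subrr; case: n kn => //.
by rewrite leqn0 => /eqP k00; rewrite k00 in k0.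
Qed.

End FpsRing.
Arguments q {R}.
Arguments geo {R} k.
Arguments fps_mul : simpl never.
Arguments fps_add : simpl never.
Arguments fps_opp : simpl never.

Section Constants.
Variable R : comNzRingType.
Implicit Types (F G : fps R) (c d : R).

Definition cst c : fps R := Fps (fun n => if n is 0 then c else 0).

Lemma coef_cstM c F n : (cst c * F) n = c * F n.
Proof.
rewrite coef_fpsM big_ord_recl subn0 big1 ?addr0 // => i _.
by rewrite /= mul0r.
Qed.

Lemma cstD c d : cst (c + d) = cst c + cst d.
Proof. by apply: fpsP => -[|n]; rewrite coef_fpsD //= addr0. Qed.

Lemma cstM c d : cst (c * d) = cst c * cst d.
Proof. by apply: fpsP => -[|n]; rewrite coef_cstM //= mulr0. Qed.

Lemma cst1 : cst 1 = 1.
Proof. by apply: fpsP => -[|n]. Qed.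

End Constants.

Definition nneg (s : fps int) : Prop := forall n, 0 <= s n.

Lemma nneg0 : nneg 0. Proof. by []. Qed.
Lemma nneg1 : nneg 1. Proof. by move=> n; rewrite coef_fps1 ler0n. Qed.

Lemma nnegD s t : nneg s -> nneg t -> nneg (s + t).
Proof. by move=> s0 t0 n; rewrite coef_fpsD addr_ge0. Qed.

Lemma nnegM s t : nneg s -> nneg t -> nneg (s * t).
Proof. by move=> s0 t0 n; rewrite coef_fpsM sumr_ge0 // => i _; rewrite mulr_ge0. Qed.

Lemma nneg_q k : nneg (q ^+ k).
Proof. by move=> n; rewrite coef_q ler0n. Qed.

Lemma nneg_q1 : nneg q.
Proof. exact: nneg_q 1. Qed.

Lemma nneg_geo k : nneg (geo k).
Proof. by move=> n; rewrite ler0n. Qed.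

Lemma nnegX s k : nneg s -> nneg (s ^+ k).
Proof.
move=> s0; elim: k => [|k IHk]; first exact: nneg1.
by rewrite exprS; exact: nnegM.
Qed.

Lemma nneg_nat k : nneg k%:R.
Proof. by elim: k => // k IHk; rewrite -addn1 natrD; apply: nnegD => //; exact: nneg1. Qed.

Lemma nneg_prod (I : Type) (r : seq I) (P : pred I) (f : I -> fps int) :
  (forall i, nneg (f i)) -> nneg (\prod_(i <- r | P i) f i).
Proof. by move=> f0; apply: big_ind => //; exact: nnegM. Qed.

(* Coinduction: unrolling the recursion n times pushes the unknown tail beyond
   degree n. *)
Lemma nneg_corec j (f p : nat -> fps int) : (0 < j)%N ->
  (forall N, f N = p N + q ^+ j * f N.+1) -> (forall N, nneg (p N)) ->
  forall N, nneg (f N).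
Proof.
move=> j0 fE p0 N n; elim/ltn_ind: n N => n IHn N.
rewrite fE coef_fpsD coef_qnM addr_ge0 ?p0 //; case: ltnP => // jn.
by apply: IHn; rewrite ltn_subrL j0 (leq_trans j0 jn).
Qed.

(** * Characters of SO(3) *)

(** The coefficient of z^m in (z + 1/z)^i, as a count of walks with steps 1 and -1. *)
Fixpoint walks (i : nat) (m : int) : int :=
  if i is i'.+1 then walks i' (m - 1) + walks i' (m + 1) else (m == 0)%:R.

Lemma walksN i m : walks i (- m) = walks i m.
Proof.
elim: i m => [|i IHi] m /=; first by rewrite oppr_eq0.
by rewrite -opprD IHi addrC -{1}(opprK (1 : int)) -opprD IHi.
Qed.

(* [ev m p] is the coefficient of z^m in p(z + 1/z). *)
Definition ev (m : int) (p : {poly int}) : int :=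
  \sum_(i < size p) p`_i * walks i m.

Implicit Types p r : {poly int}.

Lemma ev_widen N m p : (size p <= N)%N -> ev m p = \sum_(i < N) p`_i * walks i m.
Proof.
move=> pN; rewrite /ev (big_ord_widen _ (fun i => p`_i * walks i m) pN) big_mkcond /=.
by apply: eq_bigr => i _; case: ltnP => // ip; rewrite nth_default ?mul0r.
Qed.

Lemma evD m p r : ev m (p + r) = ev m p + ev m r.
Proof.
pose N := maxn (size p) (size r).
rewrite !(@ev_widen N) ?size_polyD ?leq_maxl ?leq_maxr // -big_split /=.
by apply: eq_bigr => i _; rewrite coefD mulrDl.
Qed.

Lemma evN m p : ev m (- p) = - ev m p.
Proof.
rewrite /ev size_polyN -sumrN; apply: eq_bigr => i _.
by rewrite coefN mulNr.
Qed.

Lemma evB m p r : ev m (p - r) = ev m p - ev m r.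
Proof. by rewrite evD evN. Qed.

Lemma evXM m p : ev m ('X * p) = ev (m - 1) p + ev (m + 1) p.
Proof.
rewrite (@ev_widen (size p).+1); last first.
  by rewrite (leq_trans (size_polyMleq _ _)) // size_polyX.
rewrite big_ord_recl coefXM mul0r add0r /ev -big_split /=.
by apply: eq_bigr => i _; rewrite coefXM /= mulrDr.
Qed.

Lemma ev_sym m p : ev (- m) p = ev m p.
Proof. by apply: eq_bigr => i _; rewrite walksN. Qed.

Lemma ev1 m : ev m 1 = (m == 0)%:R.
Proof. by rewrite /ev size_poly1 big_ord1 coef1 mul1r. Qed.

(* Under y = z + 1/z, [chi a] is z^-a + ... + z^a, the irreducible character of
   SO(3) of dimension 2a + 1. *)
Fixpoint chi (a : nat) : {poly int} :=
  if a is a'.+1 then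
    if a' is a''.+1 then 'X * chi a' - chi a'' else 1 + 'X
  else 1.

Lemma chiSS a : chi a.+2 = 'X * chi a.+1 - chi a. Proof. by []. Qed.

(** Clebsch-Gordan: the left-hand product gains exactly the two top constituents. The induction
    carries a and a + 1 together because [chi] obeys a second-order recurrence. *)
Lemma chi_prod a b :
  chi a.+1 * chi b.+1 = chi a * chi b + chi (a + b).+2 + chi (a + b).+1.
Proof.
suff: chi a.+1 * chi b.+1 = chi a * chi b + chi (a + b).+2 + chi (a + b).+1 /\
  chi a.+2 * chi b.+1 = chi a.+1 * chi b + chi (a.+1 + b).+2 + chi (a.+1 + b).+1.
  by case.
elim: a => [|a [IH1 IH2]].
  split; rewrite ?add0n ?add1n !chiSS /=; ring.
split=> //; rewrite (chiSS a.+1) mulrBl -mulrA IH2 IH1 [chi a.+2 in RHS]chiSS.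
rewrite !addSn (chiSS (a + b).+2) (chiSS (a + b).+1) (chiSS (a + b)); ring.
Qed.

(* The multiplicity of [chi m] in the virtual character p. *)
Definition mult (m : nat) (p : {poly int}) : int := ev m%:Z p - ev m.+1%:Z p.

Lemma multD m p r : mult m (p + r) = mult m p + mult m r.
Proof. by rewrite /mult !evD; ring. Qed.

Lemma multB m p r : mult m (p - r) = mult m p - mult m r.
Proof. by rewrite /mult !evB; ring. Qed.

(** Schur's lemma for the self-dual [chi m]. It follows from the recurrence of [chi]; the case of
    [chi 1] uses the symmetry of [ev] under z -> 1/z. *)
Lemma mult_chi m p : mult 0 (chi m * p) = mult m p.
Proof.
suff: forall p, mult 0 (chi m * p) = mult m p /\ mult 0 (chi m.+1 * p) = mult m.+1 p.
  by move=> /(_ p)[].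
elim: m => [|m IHm] {}p; last first.
  have [IH1 IH2] := IHm p; have [_ IH3] := IHm ('X * p); split=> //.
  rewrite chiSS mulrBl -mulrA multB IH1 mulrCA IH3 /mult !evXM.
  have -> : m.+1%:Z - 1 = m%:Z by lia.
  have -> : m.+1%:Z + 1 = m.+2%:Z by lia.
  have -> : m.+2%:Z - 1 = m.+1%:Z by lia.
  have -> : m.+2%:Z + 1 = m.+3%:Z by lia.
  by ring.
split; first by rewrite mul1r.
rewrite /= mulrDl mul1r multD /mult !evXM.
have -> : 0%:Z - 1 = - 1%:Z by lia.
have -> : 0%:Z + 1 = 1%:Z by lia.
have -> : 1%:Z - 1 = 0%:Z by lia.
have -> : 1%:Z + 1 = 2%:Z by lia.
by rewrite ev_sym; ring.
Qed.

(** Rewriting the multiplicity of [chi m] as one of [chi 0] brings [chi m] and [chi c] together,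
    where Clebsch-Gordan applies. *)
Lemma mult_chi_ge0 c m p : (forall a, 0 <= mult a p) -> 0 <= mult m (chi c * p).
Proof.
move=> p0; rewrite -mult_chi mulrA.
elim: c m => [|c IHc] [|m]; rewrite ?mulr1 ?mul1r ?mult_chi //.
rewrite chi_prod 2!mulrDl 2!multD !mult_chi.
by apply: addr_ge0; first apply: addr_ge0.
Qed.

Definition X (a : nat) : fps {poly int} := cst (chi a).

Definition E (m : nat) (F : fps {poly int}) : fps int := Fps (fun n => mult m (F n)).

Implicit Types F G : fps {poly int}.

Lemma coef_E m F n : E m F n = mult m (F n). Proof. by []. Qed.

Lemma ED m F G : E m (F + G) = E m F + E m G.
Proof. by apply: fpsP => n; rewrite coef_fpsD -multD. Qed.

Lemma EB m F G : E m (F - G) = E m F - E m G.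
Proof. by apply: fpsP => n; rewrite coef_fpsB -multB. Qed.

Lemma EqM m k F : E m (q ^+ k * F) = q ^+ k * E m F.
Proof.
apply: fpsP => n; rewrite coef_E !coef_qnM coef_E; case: ltnP => // _.
by rewrite /mult /ev size_poly0 !big_ord0.
Qed.

Lemma E_chi c F : E 0 (X c * F) = E c F.
Proof. by apply: fpsP => n; rewrite coef_E coef_cstM mult_chi. Qed.

Definition pos F : Prop := forall m, nneg (E m F).

Lemma posD F G : pos F -> pos G -> pos (F + G).
Proof. by move=> F0 G0 m; rewrite ED; exact: nnegD. Qed.

Lemma pos_qM k F : pos F -> pos (q ^+ k * F).
Proof. by move=> F0 m; rewrite EqM; apply: nnegM => //; exact: nneg_q. Qed.

Lemma pos_chi c F : pos F -> pos (X c * F).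
Proof. by move=> F0 m n; rewrite coef_E coef_cstM mult_chi_ge0 // => a; exact: F0. Qed.

Lemma pos_corec j (f p : nat -> fps {poly int}) : (0 < j)%N ->
  (forall N, f N = p N + q ^+ j * f N.+1) -> (forall N, pos (p N)) ->
  forall N, pos (f N).
Proof.
move=> j0 fE p0 N m.
apply: (@nneg_corec j (fun N => E m (f N)) (fun N => E m (p N))) => // N'.
  by rewrite {1}fE ED EqM.
exact: p0.
Qed.

Lemma E1_chi c F : E 1 (X c.+1 * F) = E c F + E c.+1 F + E c.+2 F.
Proof.
have h : X 1 * X c.+1 = X c + X c.+2 + X c.+1.
  by rewrite /X -cstM -2!cstD chi_prod mul1r.
by rewrite -E_chi mulrA h 2!mulrDl 2!ED !E_chi; ring.
Qed.

(* [Sh j N] is sum_a q^(ja) chi_(N+a); [Sh j 0] is the graded character of the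
   coordinate ring of the isotropic cone of the 3-dimensional representation. *)
Definition Sh (j N : nat) : fps {poly int} :=
  Fps (fun n => if (j %| n)%N then chi (N + n %/ j)%N else 0).

Lemma coef_Sh j N n : Sh j N n = if (j %| n)%N then chi (N + n %/ j)%N else 0.
Proof. by []. Qed.

Lemma Sh_rec j N : (0 < j)%N -> Sh j N = X N + q ^+ j * Sh j N.+1.
Proof.
move=> j0; apply: fpsP => n; rewrite coef_fpsD coef_qnM !coef_Sh.
case: ltnP => [nj|jn].
  rewrite addr0; case: n nj => [|n] nj; first by rewrite dvdn0 div0n addn0.
  by rewrite gtnNdvd.
have -> : X N n = 0 by case: n jn => //; rewrite leqNgt j0.
rewrite add0r dvdn_subl //; case: ifP => // jdn; congr chi.
by rewrite -{1}(subnK jn) divnDr // divnn j0 addn1 addSnnS.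
Qed.

Lemma Sh_rec3 j N : Sh j N.+2 = cst 'X * Sh j N.+1 - Sh j N.
Proof.
apply: fpsP => n; rewrite coef_fpsB coef_cstM !coef_Sh.
by case: ifP => _; rewrite ?mulr0 ?subr0 // !addSn chiSS.
Qed.

(** Used with [ring]: a goal is written as a combination of differences, each of which vanishes by a
    hypothesis. *)
Lemma eq_subr0 (V : zmodType) (x y : V) : x = y -> x - y = 0.
Proof. by move->; rewrite subrr. Qed.

(** Here [cst 'X] is z + 1/z, so [Sh j 0] is (1 + q^j) / ((1 - z q^j)(1 - q^j/z)): the symmetric
    algebra of V q^j with the relation of degree 2j divided out. *)
Lemma Sh_eq j : (0 < j)%N -> (1 - cst 'X * q ^+ j + q ^+ j ^+ 2) * Sh j 0 = 1 + q ^+ j.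
Proof.
move=> j0; have e0 := Sh_rec 0 j0; have e1 := Sh_rec 1 j0.
rewrite Sh_rec3 in e1; move: e0 e1; rewrite /X /= cstD cst1.
set x := q ^+ j; set y := cst _; set s0 := Sh j 0; set s1 := Sh j 1 => e0 e1.
transitivity (1 + x + (1 - x * y) * (s0 - (1 + x * s1)) +
    x * (s1 - (1 + y + x * (y * s1 - s0)))); first by ring.
by rewrite (eq_subr0 e0) (eq_subr0 e1) !mulr0 !addr0.
Qed.

Lemma Sh_prod j N e :
  Sh j N.+1 * X e.+1 = Sh j N * X e + Sh j (N + e).+2 + Sh j (N + e).+1.
Proof.
apply: fpsP => n; rewrite !coef_fpsD !(mulrC (Sh j _)) !coef_cstM !coef_Sh.
case: ifP => _; last by rewrite !mulr0 !addr0.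
by rewrite mulrC addSn chi_prod (mulrC (chi e)) !addSn addnAC.
Qed.

(** * The chain of isotropic vectors *)

Lemma X0 : X 0 = 1. Proof. exact: cst1. Qed.

(** The invariant for adding vectors, k being the degree of the last one. Read on [E 0], the second
    clause says that chi_(e+1) occurs at least as often as chi_e shifted by q^k. *)
Definition good (k : nat) G : Prop :=
  pos G /\ forall e, pos (G * (X e.+1 - q ^+ k * X e)).

Lemma pos_chi_r G c : pos G -> pos (G * X c).
Proof. by rewrite mulrC; exact: pos_chi. Qed.

Section GoodStep.
Variables (k : nat) (G : fps {poly int}).
Let j := k.+1.

(** The tail left when the factor 1 - q^k q^j of the relation v_k . v_j is multiplied into [Sh j].
    Unrolling it produces only terms made positive by [good k G]. *)
Definition shifted_diff (N : nat) := G * (Sh j N.+1 - q ^+ k * Sh j N).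

Lemma shifted_diff_rec N :
  shifted_diff N = G * (X N.+1 - q ^+ k * X N) + q ^+ j * shifted_diff N.+1.
Proof.
rewrite /shifted_diff; have := @Sh_rec j N isT; have := @Sh_rec j N.+1 isT.
move: (q ^+ j) (q ^+ k) => x w e1 e0.
by rewrite {1}e1 {1}e0; ring.
Qed.

Lemma good_step_recl :
  G * (1 - q ^+ k * q ^+ j) * Sh j 0 = G + q ^+ j * shifted_diff 0.
Proof.
rewrite /shifted_diff; have := @Sh_rec j 0 isT; rewrite X0.
move: (q ^+ j) (q ^+ k) => x w e0; rewrite mulrBr mulr1 mulrBl {1}e0; ring.
Qed.

(** The point is that [Sh j 0] times chi_(e+1) - q^j chi_e equals (1 + q^j) times [Sh j e.+1], which
    reduces the second clause of [good] for the new series to tails of the old one. *)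
Lemma good_step_chi e :
  G * (1 - q ^+ k * q ^+ j) * Sh j 0 * (X e.+1 - q ^+ j * X e) =
  (1 + q ^+ j) * (shifted_diff e + q ^+ k * (G * X e)).
Proof.
rewrite /shifted_diff.
have := @Sh_rec j 0 isT; have := @Sh_rec j e.+1 isT; have := @Sh_rec j e isT.
have := Sh_prod j 0 e; rewrite X0 add0n.
move: (q ^+ j) (q ^+ k) (X e) (X e.+1) => x w xe xe1.
move: (Sh j e) (Sh j e.+1) (Sh j e.+2) (Sh j 0) (Sh j 1) => se se1 se2 s0 s1 h0 h1 h2 h3.
have prodE : s0 * (xe1 - x * xe) = (1 + x) * se1.
  transitivity ((1 + x) * se1 + (xe1 * (s0 - (1 + x * s1)) +
    x * (s1 * xe1 - (s0 * xe + se2 + se1)) - (se1 - (xe1 + x * se2)))); first by ring.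
  by rewrite (eq_subr0 h0) (eq_subr0 h2) (eq_subr0 h3) !mulr0 subr0 !addr0.
rewrite -mulrA prodE.
transitivity ((1 + x) * (G * (se1 - w * (x * se1)))); first by ring.
have -> : x * se1 = se - xe by rewrite h1; ring.
by ring.
Qed.

Lemma good_step : good k G -> good j (G * (1 - q ^+ k * q ^+ j) * Sh j 0).
Proof.
move=> [G0 Gchi].
have Dpos N : pos (shifted_diff N).
  exact: (pos_corec (ltn0Sn k) shifted_diff_rec).
split=> [|e].
  by rewrite good_step_recl; apply: posD => //; exact: pos_qM.
have Hpos : pos (shifted_diff e + q ^+ k * (G * X e)).
  by apply: posD => //; apply: pos_qM; exact: pos_chi_r.
by rewrite good_step_chi mulrDl mul1r; apply: posD => //; exact: pos_qM.
Qed.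

Lemma good_step_E m : good k G ->
  nneg (E m (G * (1 - q ^+ k * q ^+ j) * Sh j 0) - E m G).
Proof.
move=> [G0 Gchi]; rewrite good_step_recl ED addrC addKr; apply: pos_qM => N.
exact: (pos_corec (ltn0Sn k) shifted_diff_rec).
Qed.

(* [E 1 - E 0] of [G * X c.+1] is [E c G + E c.+2 G]: all but the lowest term of
   the recursion for the new series is controlled by the positivity of
   [G * (X e.+1 - q ^+ k * X e)]. *)
Lemma rich_step : good k G -> nneg (E 0 G - 1) ->
  nneg (E 1 (G * (1 - q ^+ k * q ^+ j) * Sh j 0) -
        E 0 (G * (1 - q ^+ k * q ^+ j) * Sh j 0) -
        (E 1 G - E 0 G) - q ^+ j).
Proof.
move=> [G0 Gchi] G1.
pose rho F := E 1 F - E 0 F.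
have rhoD F H : rho (F + H) = rho F + rho H by rewrite /rho !ED; ring.
have rhoB F H : rho (F - H) = rho F - rho H by rewrite /rho !EB; ring.
have rhoq i F : rho (q ^+ i * F) = q ^+ i * rho F by rewrite /rho !EqM; ring.
have rho_chi c : rho (X c.+1 * G) = E c G + E c.+2 G.
  by rewrite /rho E1_chi E_chi; ring.
have Ediff e : nneg (E e.+1 G - q ^+ k * E e G).
  by have := Gchi e 0; rewrite mulrC mulrBl -mulrA EB EqM !E_chi.
have term e : rho (G * (X e.+1 - q ^+ k * X e)) = rho (X e.+1 * G) - q ^+ k * rho (X e * G).
  have -> : G * (X e.+1 - q ^+ k * X e) = X e.+1 * G - q ^+ k * (X e * G) by ring.
  by rewrite rhoB rhoq.
have tail N : nneg (rho (shifted_diff N.+1)).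
  apply: (@nneg_corec j (fun N => rho (shifted_diff N.+1))
    (fun N => rho (G * (X N.+2 - q ^+ k * X N.+1))) (ltn0Sn k)) => {}N.
    by rewrite shifted_diff_rec rhoD rhoq.
  rewrite term !rho_chi.
  have -> : E N.+1 G + E N.+3 G - q ^+ k * (E N G + E N.+2 G) =
    (E N.+1 G - q ^+ k * E N G) + (E N.+3 G - q ^+ k * E N.+2 G) by ring.
  exact: nnegD.
have -> : E 1 (G * (1 - q ^+ k * q ^+ j) * Sh j 0) -
    E 0 (G * (1 - q ^+ k * q ^+ j) * Sh j 0) - (E 1 G - E 0 G) - q ^+ j =
    q ^+ j * (rho (shifted_diff 0) - 1).
  by rewrite -/(rho _) -/(rho G) good_step_recl rhoD rhoq; ring.
apply: nnegM; first exact: nneg_q.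
rewrite shifted_diff_rec rhoD rhoq term rho_chi X0 mul1r.
(* [rho_chi] does not cover [X 0]. In the lowest term E 2 G dominates q^k E 1 G by [Ediff], and E 0
   G pays for the -1. *)
have -> : E 0 G + E 2 G - q ^+ k * rho G + q ^+ j * rho (shifted_diff 1) - 1 =
  (E 0 G - 1) + (E 2 G - q ^+ k * E 1 G) + q ^+ k * E 0 G + q ^+ j * rho (shifted_diff 1).
  by rewrite /rho; ring.
apply: nnegD; last by apply: nnegM => //; exact: nneg_q.
apply: nnegD; last by apply: nnegM => //; exact: nneg_q.
exact: nnegD.
Qed.

End GoodStep.

(* The graded character of the complete intersection cut out of vectors
   v_3, v_4, ..., v_(d+3) of weights 3, ..., d + 3 by the relations
   v_i . v_i = 0 and v_i . v_(i+1) = 0. *)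
Fixpoint chain (d : nat) : fps {poly int} :=
  if d is d'.+1 then
    chain d' * (1 - q ^+ (d' + 3) * q ^+ (d' + 3).+1) * Sh (d' + 3).+1 0
  else Sh 3 0.

Lemma chainS d : chain d.+1 =
  chain d * (1 - q ^+ (d + 3) * q ^+ (d + 3).+1) * Sh (d + 3).+1 0.
Proof. by []. Qed.

Lemma E_1 m : E m 1 = (m == 0)%:R.
Proof.
apply: fpsP => n; rewrite coef_E coef_fps1.
case: n => [|n]; rewrite /mult; last first.
  by rewrite /ev size_poly0 !big_ord0; case: (m == 0).
by rewrite !ev1; case: m.
Qed.

Lemma pos1 : pos 1.
Proof. by move=> m; rewrite E_1; exact: nneg_nat. Qed.

Lemma posX c : pos (X c).
Proof. by rewrite -[X c]mulr1; apply: pos_chi; exact: pos1. Qed.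

Lemma posSh j N : (0 < j)%N -> pos (Sh j N).
Proof. by move=> j0; apply: (pos_corec j0) => {}N; [exact: Sh_rec | exact: posX]. Qed.

Lemma good_chain d : good (d + 3) (chain d).
Proof.
elim: d => [|d IHd]; last by apply: good_step.
split=> [|e]; first exact: posSh.
(* The product formula of [good_step_chi] for j = 3, with no earlier vector. *)
have -> : chain 0 * (X e.+1 - q ^+ 3 * X e) = (1 + q ^+ 3) * Sh 3 e.+1.
  rewrite /=; have := @Sh_rec 3 0 isT; have := @Sh_rec 3 e.+1 isT.
  have := Sh_prod 3 0 e; rewrite X0 add0n.
  move: (q ^+ 3) (X e) (X e.+1) => x xe xe1.
  move: (Sh 3 e.+1) (Sh 3 e.+2) (Sh 3 0) (Sh 3 1) => se1 se2 s0 s1 h0 h2 h3.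
  transitivity ((1 + x) * se1 + (xe1 * (s0 - (1 + x * s1)) +
    x * (s1 * xe1 - (s0 * xe + se2 + se1)) - (se1 - (xe1 + x * se2)))); first by ring.
  by rewrite (eq_subr0 h0) (eq_subr0 h2) (eq_subr0 h3) !mulr0 subr0 !addr0.
by rewrite mulrDl mul1r; apply: posD; [|apply: pos_qM]; exact: posSh.
Qed.

Lemma E0_X c : E 0 (X c) = (c == 0)%:R.
Proof. by rewrite -[X c]mulr1 E_chi E_1. Qed.

Lemma chain_E0 d : nneg (E 0 (chain d) - 1).
Proof.
elim: d => [|d IHd].
  rewrite [chain 0]Sh_rec // ED X0 E_1 addrC addKr EqM.
  by apply: nnegM; [exact: nneg_q | exact: posSh].
have := @good_step_E _ _ 0 (good_chain d).
by move/(nnegD IHd); rewrite addrC addrA subrK.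
Qed.

(* Together with [chain_E0] this bounds the multiplicity of the 3-dimensional
   representation from below; q^i comes from the vector v_i. *)
Lemma chain_rich d :
  nneg (E 1 (chain d) - E 0 (chain d) + 1 - \sum_(3 <= i < d.+4) q ^+ i).
Proof.
elim: d => [|d IHd]; last first.
  have step : nneg (E 1 (chain d.+1) - E 0 (chain d.+1) -
      (E 1 (chain d) - E 0 (chain d)) - q ^+ d.+4).
    by rewrite -(addn3 d.+1); exact: rich_step (good_chain d) (chain_E0 d).
  have -> : \sum_(3 <= i < d.+4.+1) (q : fps int) ^+ i =
    \sum_(3 <= i < d.+4) q ^+ i + q ^+ d.+4 by rewrite big_nat_recr.
  move: (nnegD IHd step); congr nneg.
  by move: (chain d.+1) (chain d) (\sum_(_ <= i < _) _) (q ^+ _) => F G s x; ring.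
(* [X N] with N >= 2 has no trivial constituent; the terms 1 and q^3 chi_1 of [Sh 3 0] give exactly
   -1 + q^3. *)
have tail : nneg (E 1 (Sh 3 2) - E 0 (Sh 3 2)).
  apply: (@nneg_corec 3 (fun N => E 1 (Sh 3 N.+2) - E 0 (Sh 3 N.+2))
    (fun N => E 1 (X N.+2) - E 0 (X N.+2))) => // N.
    by rewrite (@Sh_rec 3 N.+2) // !ED !EqM; ring.
  by rewrite E0_X subr0; exact: posX.
rewrite big_nat1 [chain 0]Sh_rec // (@Sh_rec 3 1) // X0 !ED !EqM !ED !EqM !E_1 E0_X.
rewrite -[X 1]mulr1 E1_chi !E_1 /=.
have -> : 0 + q ^+ 3 * (1 + 0 + 0 + q ^+ 3 * E 1 (Sh 3 2)) -
    (1 + q ^+ 3 * (0 + q ^+ 3 * E 0 (Sh 3 2))) + 1 - q ^+ 3 =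
    q ^+ 3 * (q ^+ 3 * (E 1 (Sh 3 2) - E 0 (Sh 3 2))) by ring.
by do 2![apply: nnegM; first exact: nneg_q].
Qed.

(** * Comparison of the chain with the generating function of pairs *)

Definition denom (i : nat) : fps {poly int} := 1 - cst 'X * q ^+ i + q ^+ i ^+ 2.

(** The inverse of [denom i], which is (1 - z q^i)(1 - q^i/z): the numerator 1 + q^i of [Sh i 0] is
    cancelled by (1 - q^i)/(1 - q^(2i)). *)
Definition inv_denom (i : nat) : fps {poly int} := Sh i 0 * (1 - q ^+ i) * geo (i + i).

Lemma geo_addE (R : comNzRingType) i : (0 < i)%N ->
  (1 - q ^+ i * q ^+ i) * geo (i + i) = 1 :> fps R.
Proof. by move=> i0; rewrite -exprD geoE // addn_gt0 i0. Qed.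

Lemma denomV i : (0 < i)%N -> inv_denom i * denom i = 1.
Proof.
move=> i0; rewrite -(geo_addE _ i0) /inv_denom.
transitivity ((1 - q ^+ i) * geo (i + i) * (denom i * Sh i 0)); first by ring.
by rewrite Sh_eq //; ring.
Qed.

Lemma inv_denomM i : (0 < i)%N -> inv_denom i * (1 - q ^+ i * q ^+ i) = Sh i 0 * (1 - q ^+ i).
Proof.
move=> i0; rewrite /inv_denom -mulrA [geo _ * _]mulrC geo_addE //; exact: mulr1.
Qed.

(* The generating function of pairs of partitions with parts at most k, z
   marking the difference of their lengths. *)
Definition pair_gf (k : nat) : fps {poly int} := \prod_(1 <= i < k.+1) inv_denom i.

Definition qpoch (R : comNzRingType) (a b : nat) : fps R := \prod_(a <= i < b) (1 - q ^+ i).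
Arguments qpoch {R}.

Lemma qpochS (R : comNzRingType) a b : (a <= b)%N ->
  qpoch a b.+1 = qpoch a b * (1 - q ^+ b) :> fps R.
Proof. by move=> ab; rewrite /qpoch big_nat_recr. Qed.

Lemma pair_gfS k : pair_gf k.+1 = pair_gf k * inv_denom k.+1.
Proof. by rewrite /pair_gf big_nat_recr. Qed.

Lemma qpoch_unit (R : comNzRingType) k : exists u : fps R, qpoch 1 k.+1 * u = 1.
Proof.
elim: k => [|k [u uE]]; first by exists 1; rewrite /qpoch big_geq // mulr1.
exists (u * geo k.+1); rewrite qpochS //.
by rewrite mulrACA uE geoE // mulr1.
Qed.

(** The share of v_1 and v_2, including the relation v_1 . v_2 of degree 3 and the leftover factor 1
    - q, as [blockE] shows. The difference form exposes the coefficient of each chi_N. *)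
Definition block : fps {poly int} :=
  (1 + q ^+ 2) * Sh 1 0 - (q + q ^+ 2) * Sh 2 0.

Lemma blockE : block = (1 - q) * (1 - q ^+ 3) * Sh 1 0 * Sh 2 0.
Proof.
have := @Sh_eq 1 isT; have := @Sh_eq 2 isT; rewrite /block expr1.
move: (Sh 1 0) (Sh 2 0) => s1 s2 e2 e1.
transitivity ((1 - q) * (1 - q ^+ 3) * s1 * s2 +
    q * s2 * ((1 - cst 'X * q + q ^+ 2) * s1 - (1 + q)) -
    s1 * ((1 - cst 'X * q ^+ 2 + q ^+ 2 ^+ 2) * s2 - (1 + q ^+ 2))); first by ring.
by rewrite (eq_subr0 e1) (eq_subr0 e2) !mulr0 subr0 addr0.
Qed.

(** The factor 1 - q^5 is the relation v_2 . v_3. With k = d + 3, the relations among v_1, ..., v_k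
    have degrees 2, ..., 2k; together with 1 - q, and after division by the 1 - q^i with i <= k
    coming from Sym, the degrees k + 1, ..., 2k remain. *)
Lemma chain_pair_gf d :
  (1 - q ^+ 5) * (block * chain d) =
  pair_gf (d + 3) * qpoch (d + 3).+1 (d + 3 + (d + 3)).+1.
Proof.
(* Multiplying by a unit avoids division in the induction; it is cancelled at the end. *)
have key : (1 - q ^+ 5) * (block * chain d) * qpoch 1 (d + 3).+1 =
    pair_gf (d + 3) * qpoch 1 (d + 3 + (d + 3)).+1.
  rewrite blockE; elim: d => [|d IHd].
    rewrite /pair_gf /qpoch add0n -[index_iota 1 4]/[:: 1; 2; 3]%N.
    rewrite -[index_iota 1 7]/[:: 1; 2; 3; 4; 5; 6]%N !big_cons !big_nil [chain 0]/=.
    have := @inv_denomM 1 isT; have := @inv_denomM 2 isT; have := @inv_denomM 3 isT.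
    move: (inv_denom _) (inv_denom _) (inv_denom _) (Sh _ _) (Sh _ _) (Sh _ _).
    rewrite expr1 => i1 i2 i3 s1 s2 s3 e3 e2 e1.
    transitivity ((1 - q) * (1 - q ^+ 3) * (1 - q ^+ 5) * (s1 * (1 - q)) *
      (s2 * (1 - q ^+ 2)) * (s3 * (1 - q ^+ 3))); first by ring.
    by rewrite -e1 -e2 -e3; ring.
  have k2 : (d.+1 + 3 + (d.+1 + 3) = (d + 3 + (d + 3)).+2)%N by rewrite !addSn !addnS.
  rewrite k2 addSn pair_gfS chainS (@qpochS _ 1 (d + 3).+1) //.
  rewrite (@qpochS _ 1 (d + 3 + (d + 3)).+2) // (@qpochS _ 1 (d + 3 + (d + 3)).+1) //.
  have -> : q ^+ (d + 3 + (d + 3)).+1 = q ^+ (d + 3) * q ^+ (d + 3).+1 :> fps {poly int}.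
    by rewrite -exprD; congr (q ^+ _); lia.
  have -> : q ^+ (d + 3 + (d + 3)).+2 = q ^+ (d + 3).+1 * q ^+ (d + 3).+1 :> fps {poly int}.
    by rewrite -exprD; congr (q ^+ _); lia.
  have := @inv_denomM (d + 3).+1 isT.
  move: IHd; move: (qpoch 1 (d + 3).+1) (qpoch 1 (d + 3 + (d + 3)).+1) => Q Q2.
  move: (pair_gf _) (inv_denom _) (chain d) => C i c.
  move: (Sh 1 0) (Sh 2 0) (Sh (d + 3).+1 0) (q ^+ (d + 3)) (q ^+ (d + 3).+1) => s1 s2 s x w IHd e.
  transitivity (((1 - q ^+ 5) * ((1 - q) * (1 - q ^+ 3) * s1 * s2 * c) * Q) * (1 - x * w) *
     (s * (1 - w))); first by ring.
  by rewrite IHd -e; ring.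
have [u uE] := qpoch_unit {poly int} (d + 3).
have cancel (F H : fps {poly int}) : F * qpoch 1 (d + 3).+1 = H * qpoch 1 (d + 3).+1 -> F = H.
  by move=> FH; have := congr1 (fun Z => Z * u) FH; rewrite -!mulrA uE !mulr1.
apply: cancel; rewrite key -mulrA; congr (_ * _).
by rewrite mulrC /qpoch -big_cat_nat //= ltnS leq_addr.
Qed.

Lemma coef_qpochM (R : comNzRingType) (F : fps R) a b n : (n < a)%N ->
  (F * qpoch a b) n = F n.
Proof.
move=> na; elim: b => [|b IHb]; first by rewrite /qpoch big_geq // mulr1.
rewrite /qpoch; case: (leqP a b) => ab; last by rewrite big_geq // mulr1.
rewrite big_nat_recr // -/(qpoch _ _) mulrA mulrC mulrBl mul1r coef_fpsB coef_qnM IHb.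
by rewrite (leq_trans na ab) subr0.
Qed.

(** * Partitions into allowed parts *)

Lemma nneg_23 j : (1 < j)%N -> nneg ((1 - q ^+ j) * (geo 2 * geo 3)).
Proof.
elim/ltn_ind: j => -[|[|[|[|j]]]] // IHj _.
- by rewrite mulrA geoE // mul1r; exact: nneg_geo.
- by rewrite mulrCA geoE // mulr1; exact: nneg_geo.
have -> : (1 - q ^+ j.+4) * (geo 2 * geo 3) =
    (1 - q ^+ 2) * geo 2 * geo 3 + q ^+ 2 * ((1 - q ^+ j.+2) * (geo 2 * geo 3)) :> fps int.
  have -> : (q : fps int) ^+ j.+4 = q ^+ 2 * q ^+ j.+2 by rewrite -exprD.
  by ring.
rewrite geoE // mul1r; apply: nnegD; first exact: nneg_geo.
by apply: nnegM; [exact: nneg_q | exact: IHj].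
Qed.

Lemma nnegB1_geo i : nneg (geo i - 1).
Proof.
move=> n; rewrite coef_fpsB coef_fps1 /=; case: n => [|n]; first by rewrite dvdn0 subrr.
by rewrite subr0 ler0n.
Qed.

(* Deleting one part from a nonempty partition. *)
Lemma prod_geo_bound (r : seq nat) : all (leq 1) r ->
  nneg (1 - \prod_(i <- r) geo i + (\sum_(i <- r) q ^+ i) * \prod_(i <- r) geo i).
Proof.
elim: r => [_|i r IHr /= /andP[i0 /IHr {IHr}]].
  by rewrite !big_nil subrr mul0r addr0; exact: nneg0.
rewrite !big_cons; have gE : (1 - q ^+ i) * geo i = 1 :> fps int by exact: geoE.
have : nneg (\prod_(j <- r) geo j) by apply: nneg_prod => j; exact: nneg_geo.
have : nneg (\sum_(j <- r) q ^+ j).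
  by apply: big_ind => //; [exact: nnegD | move=> j _; exact: nneg_q].
move: (\prod_(j <- r) _) (\sum_(j <- r) _) (nnegB1_geo i) gE => p s.
move: (geo i) (q ^+ i) => g x g1 gE s0 p0 IH.
have -> : 1 - g * p + (x + s) * (g * p) =
    (1 - p + s * p) + s * p * (g - 1) + p * (1 - (1 - x) * g) by ring.
rewrite gE subrr mulr0 addr0; apply: nnegD => //.
by apply: nnegM => //; exact: nnegM.
Qed.

Definition allowed (i : nat) : bool := (i != 1 %[mod 6]) && (i != 5 %[mod 6]).

(** The parts 2 and 3 are kept apart: [geo 2] and [geo 3] absorb factors 1 - q^j, while the other
    parts are only bounded. *)
Definition big_parts (k : nat) : seq nat := [seq i <- index_iota 4 k.+1 | allowed i].

Definition big_gf (k : nat) : fps int := \prod_(i <- big_parts k) geo i.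

Definition allowed_gf (k : nat) : fps int := \prod_(2 <= i < k.+1 | allowed i) geo i.

Lemma allowed_gfE k : (3 <= k)%N -> allowed_gf k = geo 2 * geo 3 * big_gf k.
Proof.
move=> k3; rewrite /allowed_gf /big_gf big_filter (@big_cat_nat _ _ _ 4) //=.
by rewrite -[index_iota 2 4]/[:: 2; 3]%N !big_cons big_nil mulr1.
Qed.

Lemma coef_sum_q (r : seq nat) n : uniq r -> (\sum_(i <- r) q ^+ i : fps int) n = (n \in r)%:R.
Proof.
elim: r => [|i r IHr] /=; first by rewrite big_nil.
case/andP=> ir /IHr {}IHr; rewrite big_cons coef_fpsD IHr coef_q inE.
by case: eqP => [->|_] /=; rewrite ?(negbTE ir) ?addr0 ?add0r.
Qed.

Lemma big_parts_bound k :
  nneg (q ^+ 4 + q ^+ 6 + q ^+ 8 * geo 1 - \sum_(i <- big_parts k) q ^+ i).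
Proof.
move=> n; rewrite coef_fpsB !coef_fpsD !coef_q coef_qnM coef_sum_q; last first.
  by rewrite filter_uniq // iota_uniq.
rewrite subr_ge0 mem_filter mem_index_iota /geo /= dvd1n.
case: (ltnP n 8) => n8; last by case: (_ && _); case: (n == 4%N); case: (n == 6).
by case: n n8 => [|[|[|[|[|[|[|[|n]]]]]]]] //= _; case: ltnP.
Qed.

(** [prod_geo_bound] for the list of parts repeated twice, since the square stands for two
    partitions. *)
Lemma big_gf_sqr_bound k : nneg (1 - big_gf k ^+ 2 +
  2%:R * (q ^+ 4 + q ^+ 6 + q ^+ 8 * geo 1) * big_gf k ^+ 2).
Proof.
have : nneg (1 - big_gf k ^+ 2 + 2%:R * (\sum_(i <- big_parts k) q ^+ i) * big_gf k ^+ 2).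
  have := @prod_geo_bound (big_parts k ++ big_parts k); rewrite !big_cat /= -/(big_gf k).
  rewrite mulr_natl mulr2n expr2; apply.
  by rewrite all_cat andbb all_filter; apply/allP => i; rewrite mem_index_iota /=; lia.
have Rpos : nneg (big_gf k ^+ 2) by apply: nnegX; apply: nneg_prod => i; exact: nneg_geo.
have := nnegM (nnegM (nneg_nat 2) (big_parts_bound k)) Rpos.
by move=> h1 h2; have := nnegD h1 h2; congr nneg; ring.
Qed.

(** * The remaining one-variable inequality *)

(* The right-hand side is the expansion of the rational function on the left,
   grouped by residues modulo 6. *)
Lemma window_identity (R : comNzRingType) (x g : R) : (1 - x ^+ 6) * g = 1 ->
  (1 - x ^+ 5) * (1 - x + x ^+ 4 + x ^+ 5 + x ^+ 6) *
    ((1 + x ^+ 2 + x ^+ 4) * g) ^+ 2 * ((1 + x ^+ 3) * g) ^+ 2 +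
  (x + x ^+ 5 + x ^+ 7) -
  (x + x ^+ 5 + x ^+ 7) * (2%:R * (x ^+ 4 + x ^+ 6 +
    x ^+ 8 * ((1 + x + x ^+ 2 + x ^+ 3 + x ^+ 4 + x ^+ 5) * g))) =
  (1 + 2%:R * x ^+ 2 + 2%:R * x ^+ 4 + 7%:R * x ^+ 6 + 12%:R * x ^+ 8
    + 4%:R * x ^+ 9 + 13%:R * x ^+ 10 + 8%:R * x ^+ 11 + 25%:R * x ^+ 12
    + 11%:R * x ^+ 13 + 33%:R * x ^+ 14 + 25%:R * x ^+ 15
    + 37%:R * x ^+ 16 + 36%:R * x ^+ 17) +
  x ^+ 18 * (
    (21%:R + 11%:R * x + 31%:R * x ^+ 2 + 25%:R * x ^+ 3 + 37%:R * x ^+ 4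
    + 36%:R * x ^+ 5) * g +
    (20%:R + 16%:R * x + 25%:R * x ^+ 2 + 23%:R * x ^+ 3 + 28%:R * x ^+ 4
    + 28%:R * x ^+ 5) * g ^+ 2 +
    15%:R * (1 + x + x ^+ 2 + x ^+ 3 + x ^+ 4 + x ^+ 5) * g ^+ 3).
Proof.
move=> gE.
transitivity (
  (1 - x ^+ 5) * (1 - x + x ^+ 4 + x ^+ 5 + x ^+ 6) *
    ((1 + x ^+ 2 + x ^+ 4) * g) ^+ 2 * ((1 + x ^+ 3) * g) ^+ 2 +
  (x + x ^+ 5 + x ^+ 7) * ((1 - x ^+ 6) * g) ^+ 4 -
  (x + x ^+ 5 + x ^+ 7) * (2%:R * ((x ^+ 4 + x ^+ 6) * ((1 - x ^+ 6) * g) ^+ 4 +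
    x ^+ 8 * ((1 + x + x ^+ 2 + x ^+ 3 + x ^+ 4 + x ^+ 5) * g) * ((1 - x ^+ 6) * g) ^+ 3))).
  by rewrite gE !expr1n !mulr1.
transitivity (
  (1 + 2%:R * x ^+ 2 + 2%:R * x ^+ 4 + 7%:R * x ^+ 6 + 12%:R * x ^+ 8
    + 4%:R * x ^+ 9 + 13%:R * x ^+ 10 + 8%:R * x ^+ 11 + 25%:R * x ^+ 12
    + 11%:R * x ^+ 13 + 33%:R * x ^+ 14 + 25%:R * x ^+ 15
    + 37%:R * x ^+ 16 + 36%:R * x ^+ 17) * ((1 - x ^+ 6) * g) ^+ 4 +
  x ^+ 18 * (
    (21%:R + 11%:R * x + 31%:R * x ^+ 2 + 25%:R * x ^+ 3 + 37%:R * x ^+ 4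
    + 36%:R * x ^+ 5) * g * ((1 - x ^+ 6) * g) ^+ 3 +
    (20%:R + 16%:R * x + 25%:R * x ^+ 2 + 23%:R * x ^+ 3 + 28%:R * x ^+ 4
    + 28%:R * x ^+ 5) * g ^+ 2 * ((1 - x ^+ 6) * g) ^+ 2 +
    15%:R * (1 + x + x ^+ 2 + x ^+ 3 + x ^+ 4 + x ^+ 5) * g ^+ 3 * ((1 - x ^+ 6) * g))).
  by ring.
by rewrite gE !expr1n !mulr1.
Qed.

(** Brings [geo 1], [geo 2] and [geo 3] over the denominator 1 - q^6 of [window_identity]. *)
Lemma geo_expand i j (t : fps int) : (0 < i)%N -> (0 < j)%N ->
  (1 - q ^+ i) * t = 1 - q ^+ j -> geo i = t * geo j.
Proof.
move=> i0 j0 tE; rewrite -[LHS]mulr1 -(geoE _ j0) -tE.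
transitivity ((1 - q ^+ i) * geo i * (t * geo j)); first by ring.
by rewrite geoE // mul1r.
Qed.

Definition window : fps int := 1 - q + q ^+ 4 + q ^+ 5 + q ^+ 6.

Definition exceptions : fps int := q + q ^+ 5 + q ^+ 7.

Ltac nneg_tac :=
  repeat first [exact: nneg1 | exact: nneg_q1 | exact: nneg_q | exact: nneg_geo
    | exact: nneg_nat | apply: nnegD | apply: nnegM | apply: nnegX].

Lemma nneg_exceptions : nneg exceptions.
Proof. by rewrite /exceptions; nneg_tac. Qed.

Lemma window_bound :
  nneg ((1 - q ^+ 5) * window * geo 2 ^+ 2 * geo 3 ^+ 2 + exceptions -
        exceptions * (2%:R * (q ^+ 4 + q ^+ 6 + q ^+ 8 * geo 1))).
Proof.
rewrite /window /exceptions.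
rewrite (@geo_expand 2 6 (1 + q ^+ 2 + q ^+ 4)) //; last by ring.
rewrite (@geo_expand 3 6 (1 + q ^+ 3)) //; last by ring.
rewrite (@geo_expand 1 6 (1 + q + q ^+ 2 + q ^+ 3 + q ^+ 4 + q ^+ 5)) //; last by ring.
by rewrite window_identity ?geoE //; nneg_tac.
Qed.

Lemma nneg_big_gf k : nneg (big_gf k).
Proof. by apply: nneg_prod => i; exact: nneg_geo. Qed.

(** Multiply [window_bound] by [big_gf k ^+ 2] and add [exceptions] times [big_gf_sqr_bound]: the
    multiples of [exceptions] by [big_gf k ^+ 2] cancel, leaving the bare polynomial. *)
Lemma allowed_window_bound k : (3 <= k)%N ->
  nneg (allowed_gf k ^+ 2 * (1 - q ^+ 5) * window + exceptions).
Proof.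
move=> k3; rewrite allowed_gfE //.
have h1 := nnegM window_bound (nnegX 2 (nneg_big_gf k)).
have h2 := nnegM nneg_exceptions (big_gf_sqr_bound k).
by have := nnegD h1 h2; congr nneg; move: window exceptions => w e; ring.
Qed.

(** * Positivity of the multiplicities *)

Definition beta (k : nat) : fps int := allowed_gf k ^+ 2 * (1 - q ^+ 5).

(** [allowed_gf k ^+ 2] contains [geo 2 * geo 3] twice: one copy absorbs 1 - q^5, the other 1 -
    q^j. *)
Lemma nneg_beta k j : (3 <= k)%N -> (1 < j)%N -> nneg (beta k * (1 - q ^+ j)).
Proof.
move=> k3 j1; rewrite /beta allowed_gfE //.
have := nnegM (nnegM (nneg_23 (isT : 1 < 5)%N) (nneg_23 j1)) (nnegX 2 (nneg_big_gf k)).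
by congr nneg; ring.
Qed.

(** What is left of [block] after the terms chi_0, ..., chi_(N-1), divided by q^N. As chi_N has
    weight q^(2N) in [Sh 2 0], a factor q^N stays. *)
Definition block_tail (N : nat) : fps {poly int} :=
  (1 + q ^+ 2) * Sh 1 N - q ^+ N * ((q + q ^+ 2) * Sh 2 N).

Definition block_coef (N : nat) : fps int :=
  (1 - q ^+ N.+1) + q ^+ 2 * (1 - q ^+ N).

Lemma block_tail_E m N (G : fps {poly int}) :
  E m (block_tail N * G) = block_coef N * E m (X N * G) + q * E m (block_tail N.+1 * G).
Proof.
have -> : block_tail N * G = X N * G + q ^+ 2 * (X N * G) - q ^+ N.+1 * (X N * G) -
    q ^+ N.+2 * (X N * G) + q ^+ 1 * (block_tail N.+1 * G).
  rewrite /block_tail; have := @Sh_rec 1 N isT; have := @Sh_rec 2 N isT.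
  rewrite !exprS expr0 mulr1; move: (Sh 1 N) (Sh 2 N) (Sh 1 N.+1) (Sh 2 N.+1) (X N) (q ^+ N).
  by move=> s1 s2 t1 t2 y w -> ->; ring.
rewrite ED 2!EB ED !EqM /block_coef !exprS expr0 !mulr1.
by move: (E _ _) (E _ _) (q ^+ N) => a b w; ring.
Qed.

Lemma nneg_block_coef k N : (3 <= k)%N -> nneg (beta k * block_coef N.+1).
Proof.
move=> k3; case: N => [|N].
  (* Taken alone, the summand q^2 (1 - q) is out of reach of [nneg_beta]. *)
  have -> : block_coef 1 = 1 - q ^+ 3 by rewrite /block_coef; ring.
  exact: nneg_beta.
rewrite mulrDr mulrCA; apply: nnegD; first exact: nneg_beta.
by apply: nnegM; [exact: nneg_q | exact: nneg_beta].
Qed.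

Lemma nneg_block_tail k m N (G : fps {poly int}) : (3 <= k)%N -> pos G ->
  nneg (beta k * E m (block_tail N.+1 * G)).
Proof.
move=> k3 G0; move: N; apply: (@nneg_corec 1 (fun N => beta k * E m (block_tail N.+1 * G))
  (fun N => beta k * block_coef N.+1 * E m (X N.+1 * G))) => // N.
  by rewrite block_tail_E expr1; ring.
by apply: nnegM; [exact: nneg_block_coef | exact: pos_chi].
Qed.

(** The terms from chi_2 on are discarded. The coefficient 1 - q of chi_0 is not covered by
    [nneg_beta], so the chi_1 term is kept to compensate it. *)
Lemma block_E k m (G : fps {poly int}) : (3 <= k)%N -> pos G ->
  nneg (beta k * E m (block * G) -
        beta k * ((1 - q) * E m G + q * (1 - q ^+ 3) * E m (X 1 * G))).
Proof.
move=> k3 G0.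
have -> : block = block_tail 0 by rewrite /block /block_tail expr0 mul1r.
rewrite block_tail_E block_tail_E X0 mul1r.
have := nnegM (nneg_q 2) (@nneg_block_tail k m 1 G k3 G0).
by congr nneg; rewrite /block_coef expr0; move: (E _ _) (E _ _) (E _ _) => a b c; ring.
Qed.

Lemma coef_fpsM_eq (R : comNzRingType) (S F G : fps R) n :
  (forall i, (i <= n)%N -> F i = G i) -> (S * F) n = (S * G) n.
Proof.
by move=> FG; rewrite !coef_fpsM; apply: eq_bigr => i _; rewrite FG ?leq_subr.
Qed.

Lemma EqBM m k (F : fps {poly int}) : E m ((1 - q ^+ k) * F) = (1 - q ^+ k) * E m F.
Proof.
have -> : (1 - q ^+ k) * F = F - q ^+ k * F by ring.
by rewrite EB EqM; ring.
Qed.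

(** The surplus factors in [chain_pair_gf] start in degree d + 4, beyond n. *)
Lemma allowed_pair_coef d m n : (n <= d + 3)%N ->
  (allowed_gf (d + 3) ^+ 2 * E m (pair_gf (d + 3))) n =
  (beta (d + 3) * E m (block * chain d)) n.
Proof.
move=> nd; rewrite /beta -mulrA.
have -> : (1 - q ^+ 5) * E m (block * chain d) =
    E m (pair_gf (d + 3) * qpoch (d + 3).+1 (d + 3 + (d + 3)).+1).
  rewrite -chain_pair_gf -EqBM //.
apply: coef_fpsM_eq => i /leq_trans/(_ nd) id.
by rewrite !coef_E coef_qpochM // ltnS.
Qed.

(** Since chi_1 chi_(m+1) contains chi_(m+1), the bound of [block_E] leaves at least 1 - q + q (1 -
    q^3) = 1 - q^4, which [beta] absorbs. This containment fails for the trivial character. *)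
Lemma allowed_pair_ge0 d m n : (n <= d + 3)%N ->
  0 <= (allowed_gf (d + 3) ^+ 2 * E m.+1 (pair_gf (d + 3))) n.
Proof.
move=> nd; rewrite allowed_pair_coef //.
have k3 : (3 <= d + 3)%N by rewrite leq_addl.
have [G0 _] := good_chain d.
have E1X : nneg (E m.+1 (X 1 * chain d) - E m.+1 (chain d)).
  have -> : E m.+1 (X 1 * chain d) - E m.+1 (chain d) = E m (chain d) + E m.+2 (chain d).
    rewrite -E_chi mulrA [X m.+1 * X 1]mulrC.
    have -> : X 1 * X m.+1 = X m + X m.+2 + X m.+1.
      by rewrite /X -cstM -2!cstD chi_prod mul1r.
    by rewrite 2!mulrDl 2!ED !E_chi; ring.
  exact: nnegD.
suff: nneg (beta (d + 3) * E m.+1 (block * chain d)) by apply.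
have h1 := @block_E (d + 3) m.+1 _ k3 G0.
have h2 := nnegM (nneg_q 1) (nnegM (@nneg_beta _ 3 k3 isT) E1X).
have h3 := nnegM (@nneg_beta _ 4 k3 isT) (G0 m.+1).
have := nnegD h1 (nnegD h2 h3); congr nneg.
by move: (E _ _) (E _ _) (E _ _) => a b c; ring.
Qed.

(* With s = q^3 + ... + q^(d+3) from [chain_rich], the bounds add up to
   beta (1 - q + q (1 - q^3) s), and (1 - q^3) s is q^3 + q^4 + q^5 up to terms of
   degree greater than d + 3: this is [window]. *)
Lemma allowed_pair0_ge0 d n : (n <= d + 3)%N -> n \notin [:: 1; 5; 7]%N ->
  0 <= (allowed_gf (d + 3) ^+ 2 * E 0 (pair_gf (d + 3))) n.
Proof.
move=> nd n157; rewrite allowed_pair_coef //.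
have k3 : (3 <= d + 3)%N by rewrite leq_addl.
have [G0 _] := good_chain d.
pose s : fps int := \sum_(3 <= i < d.+4) q ^+ i.
have sE : (1 - q) * s = q ^+ 3 - q ^+ d.+4.
  rewrite /s; elim: (d) => [|d' IHd]; first by rewrite big_nat1; ring.
  by rewrite big_nat_recr //= mulrDr IHd (exprS _ d'.+4); ring.
have h1 := @block_E (d + 3) 0 _ k3 G0.
have h2 := nnegM (nneg_q 1) (nnegM (@nneg_beta _ 3 k3 isT) (chain_rich d)).
have h3 := nnegM (@nneg_beta _ 4 k3 isT) (chain_E0 d).
have h4 := @allowed_window_bound _ k3.
have := nnegD (nnegD h1 h4) (nnegD h2 h3).
rewrite E_chi -/s -/(beta _) => bound.
(* The truncation of s costs a multiple of q^(d+4), invisible in degree n. *)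
have : nneg (beta (d + 3) * E 0 (block * chain d) + exceptions +
    q ^+ d.+4 * (beta (d + 3) * q * (1 + q + q ^+ 2))).
  move: bound; congr nneg; move: sE; rewrite /window expr1.
  move: s (beta _) (E 0 (block * _)) (E 0 (chain d)) (E 1 _) (q ^+ d.+4) exceptions.
  move=> s b a c r w e sE.
  transitivity (b * a + e + w * (b * q * (1 + q + q ^+ 2)) -
     b * q * (1 + q + q ^+ 2) * ((1 - q) * s - (q ^+ 3 - w))); first by ring.
  by rewrite sE subrr mulr0 subr0.
have nd4 : (n < d.+4)%N by rewrite ltnS -addn3.
move=> /(_ n); rewrite !coef_fpsD coef_qnM nd4 addr0.
rewrite !coef_q -{1}[q]expr1 coef_q; move: n157; rewrite !inE !negb_or.
by case/and3P => /negbTE-> /negbTE-> /negbTE->; rewrite !addr0.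
Qed.

(** * Counting *)

Lemma is_partition_cons i s :
  is_partition (i :: s) = [&& (0 < i)%N, all (fun j => (j <= i)%N) s & is_partition s].
Proof.
rewrite /is_partition inE negb_or /= path_sortedE; last first.
  by move=> a b c ab bc; exact: leq_trans bc ab.
by rewrite lt0n eq_sym; case: (i == 0%N) => //=; rewrite ?andbF // andbA.
Qed.

Section PartsList.
Variable A : pred nat.

(* f is fuel; n + k is enough. *)
Fixpoint parts_list (f k n : nat) : seq (seq nat) :=
  if k is k'.+1 then
    if f is f'.+1 then
      (if (k <= n)%N && A k then [seq k :: s | s <- parts_list f' k (n - k)] else [::])
        ++ parts_list f' k' n
    else [::]
  else if n is 0 then [:: [::]] else [::].

Lemma parts_list_fuel f f' k n : (n + k <= f)%N -> (n + k <= f')%N ->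
  parts_list f k n = parts_list f' k n.
Proof.
elim: f f' k n => [|f IHf] [|f'] [|k] n //=; try by lia.
move=> nf nf'; congr (_ ++ _); last by apply: IHf; lia.
by case: ifP => // /andP[kn _]; congr map; apply: IHf; lia.
Qed.

Definition partitions k n := parts_list (n + k) k n.

Lemma partitions0 n : partitions 0 n = if n is 0 then [:: [::]] else [::].
Proof. by rewrite /partitions addn0; case: n. Qed.

Lemma partitionsS k n : partitions k.+1 n =
  (if (k.+1 <= n)%N && A k.+1
   then [seq k.+1 :: s | s <- partitions k.+1 (n - k.+1)] else [::]) ++ partitions k n.
Proof.
rewrite /partitions {1}addnS [LHS]/=; congr (_ ++ _).
by case: ifP => // /andP[kn _]; congr map; apply: parts_list_fuel; lia.
Qed.

Lemma mem_partitions k n s : (s \in partitions k n) =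
  [&& is_partition s, all (fun i => (i <= k)%N) s, all A s & sumn s == n].
Proof.
have [N] := ubnP (n + k); elim: N k n s => // N IHN [|k] n s nN.
  rewrite partitions0; case: s => [|i s].
    by case: n {nN} => [|n]; rewrite ?inE.
  have -> : (i :: s \in if n is 0 then [:: [::]] else [::]) = false by case: (n).
  case: i => [|i] /=; first by rewrite /is_partition inE eqxx andbF.
  by rewrite andbF.
rewrite partitionsS mem_cat IHN; last by lia.
case: s => [|i s].
  rewrite /=; case: ifP => _; last by [].
  by case: mapP => // -[].
have mem_map_cons (L : seq (seq nat)) :
    (i :: s \in [seq k.+1 :: t | t <- L]) = (i == k.+1) && (s \in L).
  apply/mapP/andP => [[t tL [-> ->]]|[/eqP-> sL]]; first by rewrite eqxx.
  by exists s.
have -> : (i :: s \in if (k < n)%N && A k.+1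
      then [seq k.+1 :: t | t <- partitions k.+1 (n - k.+1)] else [::]) =
    [&& (k < n)%N, A k.+1, i == k.+1 & s \in partitions k.+1 (n - k.+1)].
  by case: (k < n)%N; case: (A k.+1) => //=; rewrite mem_map_cons.
rewrite is_partition_cons /=; apply/idP/idP.
  case/orP => [/and4P[kn Ak /eqP-> sL]|].
    move: sL; rewrite IHN; last by lia.
    by case/and4P => sp sk sA /eqP ss; rewrite sp sk sA Ak ss leqnn /=; apply/eqP; lia.
  case/and4P => /and3P[i0 si sp] /andP[ik sk] -> ->; rewrite i0 si sp !andbT /=.
  by rewrite (leq_trans ik) //=; apply: sub_all sk => j /leq_trans->.
case/and4P => /and3P[i0 si sp] /andP[ik sk] /andP[Ai sA] sn.
rewrite i0 si sp Ai sA sn !andbT; move: ik; rewrite leq_eqVlt ltnS => /orP[/eqP ik|ik].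
  subst i; move/eqP: sn => /= sn; apply/orP; left.
  rewrite Ai eqxx IHN; last by lia.
  by rewrite sp sA sk /=; apply/andP; split; [lia | apply/eqP; lia].
rewrite ik /=; apply/orP; right; apply: sub_all si => j /leq_trans->//.
Qed.

Lemma partitions_uniq k n : uniq (partitions k n).
Proof.
have [N] := ubnP (n + k); elim: N k n => // N IHN [|k] n nN.
  by rewrite partitions0; case: n {nN}.
rewrite partitionsS cat_uniq IHN ?andbT; last by lia.
case: ifP => [/andP[kn _]|_]; last by apply/hasPn.
rewrite map_inj_uniq ?IHN /=; [|lia|by move=> ? ? []].
apply/hasPn => s; rewrite mem_partitions => /and4P[_ sk _ _].
by apply/mapP => -[t _ st]; move: sk; rewrite st /= ltnn.
Qed.

End PartsList.

Section GradedProduct.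
Variables S T : eqType.
Implicit Types (U : nat -> seq S) (V : nat -> seq T).

Definition sprod U V n : seq (S * T) :=
  flatten [seq [seq (s, t) | s <- U i, t <- V (n - i)%N] | i <- iota 0 n.+1].

Lemma big_sprod U V n (f : S * T -> int) :
  \sum_(x <- sprod U V n) f x =
  \sum_(i < n.+1) \sum_(s <- U i) \sum_(t <- V (n - i)%N) f (s, t).
Proof.
rewrite big_flatten big_map -[iota 0 n.+1]/(index_iota 0 n.+1) big_mkord.
by apply: eq_bigr => i _; rewrite big_allpairs_dep.
Qed.

Lemma size_sprod U V n : (size (sprod U V n))%:Z =
  (Fps (fun i => (size (U i))%:Z) * Fps (fun i => (size (V i))%:Z)) n.
Proof.
have size_sum (R : Type) (r : seq R) : (size r)%:Z = \sum_(x <- r) 1.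
  by rewrite big_const_seq count_predT iter_addr_0 natz.
rewrite size_sum big_sprod coef_fpsM; apply: eq_bigr => i _ /=.
rewrite !size_sum mulr_suml; apply: eq_bigr => s _.
by rewrite mul1r.
Qed.

Definition graded (R : eqType) (w : R -> nat) (L : nat -> seq R) : Prop :=
  (forall n, uniq (L n)) /\ (forall n x, x \in L n -> w x = n).

Lemma mem_sprod U V wS wT n s t : graded wS U -> graded wT V ->
  ((s, t) \in sprod U V n) = [&& s \in U (wS s), t \in V (wT t) & wS s + wT t == n]%N.
Proof.
move=> [_ wU] [_ wV]; apply/flatten_mapP/and3P => [[i]|[sU tV /eqP st]].
  rewrite mem_iota add0n ltnS => i_n /allpairsP[[s' t'] /= [sU tV [-> ->]]].
  by rewrite (wU _ _ sU) (wV _ _ tV) subnKC.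
exists (wS s); first by rewrite mem_iota; lia.
apply/allpairsP; exists (s, t); split=> //=.
by rewrite -st addKn.
Qed.

Lemma graded_sprod U V wS wT : graded wS U -> graded wT V ->
  graded (fun x => wS x.1 + wT x.2)%N (sprod U V).
Proof.
move=> gU gV; split=> [n|n [s t]]; last first.
  by rewrite (mem_sprod _ _ _ gU gV) => /and3P[_ _ /eqP].
have [uU wU] := gU; have [uV wV] := gV.
rewrite /sprod; elim: (iota 0 n.+1) (iota_uniq 0 n.+1) => //= i r IHr /andP[ir /IHr ur].
rewrite cat_uniq ur andbT allpairs_uniq //=; last by move=> [? ?] [? ?] _ _ [-> ->].
apply/hasPn => -[s t] /flatten_mapP[j jr /allpairsP[[s' t'] /= [sU _ [-> _]]]].
apply/allpairsP => -[[s2 t2] /= [s2U _ [e _]]]; move: ir.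
by rewrite -(wU _ _ s2U) -e (wU _ _ sU) jr.
Qed.

End GradedProduct.

Definition length_gf (k : nat) : fps {poly int} :=
  Fps (fun n => \sum_(s <- partitions predT k n) 'X^(size s)).

Lemma length_gfS k :
  length_gf k.+1 = length_gf k + q ^+ k.+1 * (cst 'X * length_gf k.+1).
Proof.
apply: fpsP => n; rewrite coef_fpsD coef_qnM coef_cstM addrC /length_gf /=.
rewrite partitionsS big_cat andbT /=; congr (_ + _); rewrite [(n < k.+1)%N]ltnS.
case: ltnP => kn; last by rewrite big_nil.
by rewrite big_map mulr_sumr; apply: eq_bigr => s _; rewrite -exprS.
Qed.

Definition count_gf (A : pred nat) (k : nat) : fps int :=
  Fps (fun n => (size (partitions A k n))%:Z).

Lemma count_gfS A k :
  count_gf A k.+1 = (if A k.+1 then geo k.+1 else 1) * count_gf A k.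
Proof.
have rec : count_gf A k.+1 = count_gf A k + (if A k.+1 then q ^+ k.+1 * count_gf A k.+1 else 0).
  apply: fpsP => n; rewrite coef_fpsD addrC /= partitionsS size_cat PoszD; congr (_ + _).
  case: (A k.+1); last by rewrite andbF.
  by rewrite andbT coef_qnM [(n < k.+1)%N]ltnS; case: ltnP => //= _; rewrite size_map.
move: rec; case: (A k.+1); last by rewrite addr0 mul1r.
move: (count_gf A k.+1) (count_gf A k) => F G FG.
have -> : G = (1 - q ^+ k.+1) * F by rewrite mulrBl mul1r {1}FG; ring.
by rewrite mulrA [geo _ * _]mulrC geoE // mul1r.
Qed.

Lemma count_gf_allowed k : count_gf allowed k = allowed_gf k.
Proof.
elim: k => [|k IHk].
  rewrite /allowed_gf big_geq //; apply: fpsP => n.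
  by rewrite coef_fps1 /= partitions0; case: n.
rewrite count_gfS IHk /allowed_gf; case: k {IHk} => [|k].
  by rewrite !big_geq // mulr1.
rewrite [in RHS]big_mkcond big_nat_recr //= mulrC; congr (_ * _).
by rewrite [in LHS]big_mkcond.
Qed.

(** * Pairs of partitions by difference of lengths *)

Definition coefz (p : {poly int}) (m : int) : int := if m is Posz i then p`_i else 0.

(* [ct m p r] is the coefficient of z^m in p(z) r(1/z). *)
Definition ct (m : int) (p r : {poly int}) : int :=
  \sum_(j < size r) r`_j * coefz p (j%:Z + m).

Lemma ct_widen N m p r : (size r <= N)%N ->
  ct m p r = \sum_(j < N) r`_j * coefz p (j%:Z + m).
Proof.
move=> rN; rewrite /ct (big_ord_widen _ (fun j => r`_j * coefz p (j%:Z + m)) rN) big_mkcond /=.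
by apply: eq_bigr => i _; case: ltnP => // ip; rewrite nth_default ?mul0r.
Qed.

Lemma ctDl m p1 p2 r : ct m (p1 + p2) r = ct m p1 r + ct m p2 r.
Proof.
rewrite -big_split; apply: eq_bigr => j _ /=; rewrite -mulrDr; congr (_ * _).
by case: (j%:Z + m) => i; rewrite /coefz ?coefD ?addr0.
Qed.

Lemma ctDr m p r1 r2 : ct m p (r1 + r2) = ct m p r1 + ct m p r2.
Proof.
pose N := maxn (size r1) (size r2).
rewrite !(@ct_widen N) ?size_polyD ?leq_maxl ?leq_maxr // -big_split /=.
by apply: eq_bigr => i _; rewrite coefD mulrDl.
Qed.

Lemma ct0l m r : ct m 0 r = 0.
Proof.
rewrite /ct big1 // => j _; rewrite /coefz.
by case: (j%:Z + m) => i; rewrite ?coef0 mulr0.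
Qed.

Lemma ct0r m p : ct m p 0 = 0.
Proof. by rewrite /ct size_poly0 big_ord0. Qed.

Lemma coefzXM p z : coefz ('X * p) z = coefz p (z - 1).
Proof.
case: z => [[|i]|i]; first by rewrite /coefz coefXM.
  have -> : Posz i.+1 - 1 = Posz i by lia.
  by rewrite /coefz coefXM.
by have -> : Negz i - 1 = Negz i.+1 by lia.
Qed.

Lemma ctXl m p r : ct m ('X * p) r = ct (m - 1) p r.
Proof. by apply: eq_bigr => j _; rewrite coefzXM addrA. Qed.

Lemma ctXr m p r : ct m p ('X * r) = ct (m + 1) p r.
Proof.
rewrite (@ct_widen (size r).+1); last first.
  by rewrite (leq_trans (size_polyMleq _ _)) // size_polyX.
rewrite big_ord_recl coefXM mul0r add0r; apply: eq_bigr => j _.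
by rewrite coefXM lift0 /=; congr (_ * coefz _ _); lia.
Qed.

Lemma ctXX m a b : ct m 'X^a 'X^b = (a%:Z - b%:Z == m)%:R.
Proof.
rewrite /ct size_polyXn big_ord_recr /= big1 ?add0r; last first.
  by move=> j _; rewrite coefXn (ltn_eqF (ltn_ord j)) mul0r.
rewrite coefXn eqxx mul1r; have -> : (a%:Z - b%:Z == m) = (b%:Z + m == a%:Z) by lia.
by case: (_ + m) => i //=; rewrite coefXn.
Qed.

Lemma ct_sum m (S T : Type) (r : seq S) (r' : seq T) (f : S -> nat) (g : T -> nat) :
  ct m (\sum_(s <- r) 'X^(f s)) (\sum_(t <- r') 'X^(g t)) =
  \sum_(s <- r) \sum_(t <- r') ((f s)%:Z - (g t)%:Z == m)%:R.
Proof.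
rewrite (big_morph (fun p => ct m p _) (fun p1 p2 => ctDl m p1 p2 _) (ct0l m _)).
apply: eq_bigr => s _.
rewrite (big_morph (ct m _) (ctDr m _) (ct0r m _)).
by apply: eq_bigr => t _; rewrite ctXX.
Qed.

Definition CT (m : int) (F G : fps {poly int}) : fps int :=
  Fps (fun n => \sum_(i < n.+1) ct m (F i) (G (n - i)%N)).

Lemma coef_CT m F G n : CT m F G n = \sum_(i < n.+1) ct m (F i) (G (n - i)%N).
Proof. by []. Qed.

Lemma CTDl m F1 F2 G : CT m (F1 + F2) G = CT m F1 G + CT m F2 G.
Proof.
apply: fpsP => n; rewrite coef_fpsD -big_split.
by apply: eq_bigr => i _; rewrite /= -ctDl.
Qed.

Lemma CTDr m F G1 G2 : CT m F (G1 + G2) = CT m F G1 + CT m F G2.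
Proof.
apply: fpsP => n; rewrite coef_fpsD -big_split.
by apply: eq_bigr => i _; rewrite /= -ctDr.
Qed.

Lemma CTXl m F G : CT m (cst 'X * F) G = CT (m - 1) F G.
Proof. by apply: fpsP => n; apply: eq_bigr => i _; rewrite coef_cstM ctXl. Qed.

Lemma CTXr m F G : CT m F (cst 'X * G) = CT (m + 1) F G.
Proof. by apply: fpsP => n; apply: eq_bigr => i _; rewrite coef_cstM ctXr. Qed.

Lemma CTql m k F G : CT m (q ^+ k * F) G = q ^+ k * CT m F G.
Proof.
elim: k F => [|k IHk] F; first by rewrite !mul1r.
rewrite exprSr -mulrA IHk exprSr -mulrA; congr (_ * _); apply: fpsP => n; rewrite coef_qM.
case: n => [|n]; first by rewrite coef_CT big_ord1 coef_qM ct0l.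
by rewrite coef_CT big_ord_recl coef_qM ct0l add0r; apply: eq_bigr => i _; rewrite coef_qM.
Qed.

Lemma CTqr m k F G : CT m F (q ^+ k * G) = q ^+ k * CT m F G.
Proof.
elim: k G => [|k IHk] G; first by rewrite !mul1r.
rewrite exprSr -mulrA IHk exprSr -mulrA; congr (_ * _); apply: fpsP => n; rewrite coef_qM.
case: n => [|n]; first by rewrite coef_CT big_ord1 coef_qM ct0r.
rewrite coef_CT big_ord_recr subnn coef_qM ct0r [LHS]addr0; apply: eq_bigr => i _.
rewrite subSn ?coef_qM //; exact: leq_ord i.
Qed.

Definition EV (m : int) (F : fps {poly int}) : fps int := Fps (fun n => ev m (F n)).

Lemma coef_EV m F n : EV m F n = ev m (F n). Proof. by []. Qed.

Lemma EVD m F G : EV m (F + G) = EV m F + EV m G.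
Proof. by apply: fpsP => n; rewrite coef_fpsD -evD. Qed.

Lemma EVB m F G : EV m (F - G) = EV m F - EV m G.
Proof. by apply: fpsP => n; rewrite coef_fpsB -evB. Qed.

Lemma EVX m F : EV m (cst 'X * F) = EV (m - 1) F + EV (m + 1) F.
Proof. by apply: fpsP => n; rewrite coef_fpsD -evXM -coef_cstM. Qed.

Lemma EVq m k F : EV m (q ^+ k * F) = q ^+ k * EV m F.
Proof.
apply: fpsP => n; rewrite coef_EV !coef_qnM; case: ltnP => // _.
by rewrite /ev size_poly0 big_ord0.
Qed.

(** Both sides obey the recursion expressing multiplication by [denom k.+1]; it determines the
    coefficients by induction on the degree, for all m at once. *)
Lemma CT_length_gf m k : CT m (length_gf k) (length_gf k) = EV m (pair_gf k).
Proof.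
elim: k m => [|k IHk] m.
  have l0 : length_gf 0 = 1.
    apply: fpsP => n; rewrite coef_fps1 /= partitions0.
    by case: n => [|n]; rewrite ?big_nil // big_seq1.
  have -> : pair_gf 0 = 1 by rewrite /pair_gf big_geq.
  rewrite l0; apply: fpsP => n; rewrite coef_CT coef_EV big_ord_recl big1 ?addr0.
    rewrite subn0 !coef_fps1; case: n => [|n]; last by rewrite ct0r /ev size_poly0 big_ord0.
    by have := ctXX m 0 0; rewrite subrr expr0 ev1 (eq_sym m).
  by move=> i _; rewrite coef_fps1 ct0l.
pose x : fps int := q ^+ k.+1.
have ctE m' : CT m' (length_gf k.+1) (length_gf k.+1) = CT m' (length_gf k) (length_gf k) +
    x * (CT (m' - 1) (length_gf k.+1) (length_gf k.+1) +
         CT (m' + 1) (length_gf k.+1) (length_gf k.+1)) -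
    x ^+ 2 * CT m' (length_gf k.+1) (length_gf k.+1).
  have l m'' H : CT m'' (length_gf k.+1) H =
      CT m'' (length_gf k) H + x * CT (m'' - 1) (length_gf k.+1) H.
    by rewrite {1}length_gfS CTDl CTql CTXl.
  have r m'' H : CT m'' H (length_gf k.+1) =
      CT m'' H (length_gf k) + x * CT (m'' + 1) H (length_gf k.+1).
    by rewrite {1}length_gfS CTDr CTqr CTXr.
  (* Using [l] backwards removes the mixed term and creates the -x^2. *)
  have e := l (m' + 1) (length_gf k.+1); rewrite addrK in e.
  rewrite {1}l {1}r e; ring.
have evE m' : EV m' (pair_gf k.+1) = EV m' (pair_gf k) +
    x * (EV (m' - 1) (pair_gf k.+1) + EV (m' + 1) (pair_gf k.+1)) - x ^+ 2 * EV m' (pair_gf k.+1).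
  rewrite -EVX -exprM -!EVq -EVD -EVB; congr EV.
  have -> : pair_gf k = pair_gf k.+1 * denom k.+1 by rewrite pair_gfS -mulrA denomV // mulr1.
  by rewrite /denom -exprM; ring.
apply: fpsP => n; elim/ltn_ind: n m => n IHn m.
rewrite ctE evE IHk !coef_fpsB !coef_fpsD /x -exprM !coef_qnM !coef_fpsD.
case: ltnP => kn; first by case: ltnP => // kn'; lia.
by rewrite !IHn //; lia.
Qed.

(* Raw data (beta_1, (beta_2, (alpha_1, alpha_2))) of the bipartitions of n of
   crank m. *)
Definition raw_pairs (m : int) (k n : nat) : seq (seq nat * seq nat) :=
  [seq x <- sprod (partitions predT k) (partitions predT k) n |
    (size x.1)%:Z - (size x.2)%:Z == m].

Definition raw_class (m : int) (k n : nat) :=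
  sprod (partitions allowed k) (sprod (partitions allowed k) (raw_pairs m k)) n.

Lemma graded_partitions A k : graded sumn (partitions A k).
Proof.
split=> [n|n s]; first exact: partitions_uniq.
by rewrite mem_partitions => /and4P[_ _ _ /eqP].
Qed.

Lemma graded_raw_pairs m k : graded (fun x => sumn x.1 + sumn x.2)%N (raw_pairs m k).
Proof.
have [u w] := graded_sprod (graded_partitions predT k) (graded_partitions predT k).
split=> [n|n x]; first exact: filter_uniq.
by rewrite mem_filter => /andP[_ /w].
Qed.

Lemma count_sum (T : Type) (P : pred T) (r : seq T) :
  (count P r)%:Z = \sum_(x <- r) (P x)%:R.
Proof.
elim: r => [|x r IHr]; first by rewrite big_nil.
by rewrite big_cons -IHr /= PoszD; case: (P x).
Qed.

Lemma size_raw_class m k n :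
  (size (raw_class m k n))%:Z = (allowed_gf k ^+ 2 * EV m (pair_gf k)) n.
Proof.
have pairs : Fps (fun i => (size (raw_pairs m k i))%:Z) = EV m (pair_gf k).
  rewrite -CT_length_gf; apply: fpsP => i; rewrite coef_CT.
  transitivity (\sum_(x <- sprod (partitions predT k) (partitions predT k) i)
      ((size x.1)%:Z - (size x.2)%:Z == m)%:R : int).
    by rewrite -count_sum /= size_filter.
  by rewrite big_sprod; apply: eq_bigr => j _; rewrite ct_sum.
rewrite size_sprod -/(count_gf _ _) count_gf_allowed expr2 -mulrA.
apply: (congr1 (fun F : fps int => F n)); congr (_ * _); apply: fpsP => i.
by rewrite -pairs -count_gf_allowed -size_sprod.
Qed.

(** * From bipartitions with designated summands to quadruples of partitions *)

Section CrankClass.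
Variable Delta : dpartition -> partition_of_int * partition_npm1.
Hypothesis hDelta : pd_bijection Delta.

Definition raw (L : dpartition * dpartition) :=
  (parts (Delta L.1).2, (parts (Delta L.2).2, (parts (Delta L.1).1, parts (Delta L.2).1))).

Lemma raw_inj : injective raw.
Proof.
have [Dbij _] := hDelta.
move=> [l1 l2] [k1 k2] [] /val_inj/val_inj b1 /val_inj/val_inj b2 /val_inj a1 /val_inj a2.
congr pair; apply: (bij_inj Dbij).
  by rewrite [LHS]surjective_pairing [RHS]surjective_pairing a1 b1.
by rewrite [LHS]surjective_pairing [RHS]surjective_pairing a2 b2.
Qed.

Lemma part_le_sumn (s : seq nat) : all (fun i => (i <= sumn s)%N) s.
Proof.
elim: s => //= i s IHs; rewrite leq_addr /=.
by apply: sub_all IHs => j js; exact: leq_trans js (leq_addl _ _).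
Qed.

(** For n <= k the bound k on the parts holds automatically, so membership does not depend on k. *)
Lemma mem_raw_class m k n x : (n <= k)%N -> (x \in raw_class m k n) =
  [&& is_partition x.1 && all allowed x.1,
      is_partition x.2.1 && all allowed x.2.1,
      is_partition x.2.2.1, is_partition x.2.2.2,
      (size x.2.2.1)%:Z - (size x.2.2.2)%:Z == m &
      (sumn x.1 + (sumn x.2.1 + (sumn x.2.2.1 + sumn x.2.2.2)) == n)%N].
Proof.
move=> nk; case: x => t1 [t2 [s1 s2]] /=.
have gA := graded_partitions predT k; have gB := graded_partitions allowed k.
have gP := graded_raw_pairs m k.
rewrite (mem_sprod _ _ _ gB (graded_sprod gB gP)) (mem_sprod _ _ _ gB gP).
rewrite mem_filter (mem_sprod _ _ _ gA gA) /= !mem_partitions !eqxx !andbT !all_predT.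
have [sn|] := eqVneq (sumn t1 + (sumn t2 + (sumn s1 + sumn s2)))%N n; last by rewrite !andbF.
have le_k s : (sumn s <= n)%N -> all (fun i => (i <= k)%N) s.
  move=> /leq_trans/(_ nk) sk; apply: sub_all (part_le_sumn s) => i is_.
  exact: leq_trans is_ sk.
by rewrite !le_k; lia.
Qed.

Lemma card_crank_class m k n : (n <= k)%N -> M_bd Delta m n = size (raw_class m k n).
Proof.
move=> nk.
have [Dbij wD] := hDelta.
have finC := @finite_crank_class Delta m n.
rewrite /M_bd -(size_map raw).
apply: perm_size; apply: uniq_perm.
- by rewrite map_inj_uniq ?fset_uniq //; exact: raw_inj.
- have gB := graded_partitions allowed k.
  by have [u _] := graded_sprod gB (graded_sprod gB (graded_raw_pairs m k)); exact: u.
move=> x; rewrite mem_raw_class //; apply/mapP/idP => [[L]|].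
  rewrite in_fset_set // => /set_mem[bw cr] ->.
  rewrite /raw /= !partsP [all _ _]npm1P [all _ _]npm1P /=.
  apply/andP; split; first exact/eqP.
  by rewrite -bw /bweight -!wD /weight; lia.
case: x => t1 [t2 [s1 s2]] /= /and5P[/andP[pt1 at1] /andP[pt2 at2] ps1 ps2 /andP[/eqP sz /eqP sn]].
pose b1 := @PartitionNpm1 (PartitionOfInt pt1) at1.
pose b2 := @PartitionNpm1 (PartitionOfInt pt2) at2.
have [g _ gK] := Dbij.
exists (g (PartitionOfInt ps1, b1), g (PartitionOfInt ps2, b2)); last by rewrite /raw /= !gK.
rewrite in_fset_set //; apply/mem_set; split; last by rewrite /pd_crank /= !gK.
by rewrite /bweight /= -!wD !gK /weight /=; lia.
Qed.

End CrankClass.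

Lemma M_bd_diff (Delta : dpartition -> partition_of_int * partition_npm1) (a k n : nat) :
  pd_bijection Delta -> (n <= k)%N ->
  (M_bd Delta a n)%:Z - (M_bd Delta a.+1 n)%:Z = (allowed_gf k ^+ 2 * E a (pair_gf k)) n.
Proof.
move=> hDelta nk; rewrite !(card_crank_class hDelta _ nk) !size_raw_class.
have -> : E a (pair_gf k) = EV a (pair_gf k) - EV a.+1 (pair_gf k).
  by apply: fpsP => i; rewrite coef_fpsB !coef_EV.
by rewrite mulrBr coef_fpsB.
Qed.

(** Shows that the exceptions are genuine, by enumerating the quadruples. *)
Lemma raw_class_exceptions n : n \in [:: 1; 5; 7]%N ->
  (size (raw_class 0 n n) < size (raw_class 1 n n))%N.
Proof. by rewrite !inE => /or3P[] /eqP->; vm_compute. Qed.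

Theorem theorem4p1
  (Delta : dpartition -> partition_of_int * partition_npm1)
  (hDelta : pd_bijection Delta)
  (m : int) (n : nat) (hm : (1 <= m)%R) :
  (M_bd Delta m n <= M_bd Delta (m - 1)%R n)%N <->
  ~ (m = 1%R /\ (n = 1%N \/ n = 5%N \/ n = 7%N)).
Proof.
have [a ->] : exists a : nat, m = a.+1%:Z by exists `|m - 1|%N; lia.
have -> : a.+1%:Z - 1 = a%:Z by lia.
split=> [le_M [a1 n157]|not_exc].
  have {a1} a0 : a = 0%N by lia.
  have n_in : n \in [:: 1; 5; 7]%N by rewrite !inE; lia.
  move: le_M; rewrite a0 !(card_crank_class hDelta _ (leqnn n)) leqNgt.
  by rewrite raw_class_exceptions.
(* The chain starts at v_3, so the bound on the parts has the form d + 3; d = n reaches degree n. *)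
have nk : (n <= n + 3)%N by rewrite leq_addr.
have := M_bd_diff a hDelta nk.
suff : 0 <= (allowed_gf (n + 3) ^+ 2 * E a (pair_gf (n + 3))) n by lia.
case: a not_exc => [|a] not_exc; last exact: allowed_pair_ge0.
by apply: allowed_pair0_ge0 => //; rewrite !inE; lia.
Qed.
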